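(* Let $T>0$, $d,m,p\in\mathbb N$, $x_0\in\mathbb R^d$. Suppose that $f_0:\mathbb R^d\to\mathbb R^d$ and $f:\mathbb R^d\to\mathbb R^{d\times m}$ are globally Lipschitz and that $c:\mathbb R^d\to\mathbb R^p$ is locally Lipschitz continuous. For $u\in L^2([0,T];\mathbb R^m)$ let $x(\cdot;u)$ be the solution on $[0,T]$ of $$\dot x(t)=f_0(x(t))+f(x(t))u(t),\quad x(0)=x_0,$$ and let $y_i(\cdot;u)$ be the $i$th component of $y(\cdot;u)=c(x(\cdot;u))$, $i\in\{1,\dots,p\}$. Let $\mathcal K\subset L^2([0,T];\mathbb R^m)$ be compact. Then, for every $\varepsilon>0$ there exists an $\ell_i\in\mathcal W_{m+1}$ such that $$\sup_{t\in[0,T]}\ \sup_{u\in\mathcal K}\ |y_i(t;u)-\langle \ell_i,S_{0,t}(\hat U)\rangle|<\varepsilon ,$$ where, for each $u\in\mathcal K$, $\hat U(t)=(t,U(t)^\top)^\top\in\mathbb R^{m+1}$ with $U(t)=\int_0^t u(s)\,\mathrm ds$, $t\in[0,T]$, and $S_{0,t}(\hat U)$ is the signature of $\hat U$ over $[0,t]$.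
   Context: $\|\cdot\|$ is the Euclidean norm (and induced matrix norm). A map $g$ on $\mathbb R^d$ is locally Lipschitz if for every $R>0$ there is $L_{g,R}>0$ with $\|g(x)-g(z)\|\le L_{g,R}\|x-z\|$ for all $\|x\|,\|z\|\le R$. Solutions of the controlled equation are absolutely continuous functions satisfying the associated integral equation; under the stated assumptions a unique global solution exists on $[0,T]$ for every $u\in L^2([0,T];\mathbb R^m)$. Signature: for a continuous path of bounded variation $X:[0,T]\to\mathbb R^{M}$ and $0\le a<b\le T$, the iterated (Riemann–Stieltjes) integrals are $X^{(k)}_{a,b}=\int\cdots\int_{a<s_1<\cdots<s_k<b}\mathrm dX(s_1)\otimes\cdots\otimes \mathrm dX(s_k)\in\mathbb R^{M^k}$, where $\otimes$ is the Kronecker product, and $S_{a,b}(X)=(1,{X^{(1)}_{a,b}}^\top,{X^{(2)}_{a,b}}^\top,\dots)^\top\in\prod_{k=0}^\infty\mathbb R^{M^k}$. For $a=b$ the iterated integrals vanish, so $S_{a,a}(X)=(1,0,0,\dots)^\top$. $\mathcal W_M=\bigoplus_{k=0}^\infty\mathbb R^{M^k}$, i.e. its elements have only finitely many nonzero entries, and $\langle\ell,S\rangle$ is the (finite) sum of products of corresponding entries of $\ell\in\mathcal W_M$ and $S\in\prod_{k=0}^\infty\mathbb R^{M^k}$. Here $M=m+1$. *)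

(* Defs.v *)
From HB Require Import structures.
From mathcomp Require Import all_boot all_order all_algebra.
From mathcomp Require Import all_classical all_reals all_analysis.
From mathcomp Require Import measurable_realfun mxtens ring.

Set Implicit Arguments.
Unset Strict Implicit.
Unset Printing Implicit Defensive.

Import Order.TTheory GRing.Theory Num.Theory.
Import numFieldNormedType.Exports.

Local Open Scope classical_set_scope.
Local Open Scope ring_scope.

Section norms.
Context {R : realType}.

(* The library norm on matrices is the entrywise sup norm. *)
Definition enorm n (v : 'cV[R]_n) : R := Num.sqrt (\sum_i v i 0 ^+ 2).

Definition opnorm m n (A : 'M[R]_(m, n)) : R :=
  sup [set enorm (A *m v) | v in [set v : 'cV[R]_n | enorm v <= 1]].

Arguments enorm {n} v.
Arguments opnorm {m n} A.

Definition globally_lipschitz n (V : zmodType) (N : V -> R)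
    (g : 'cV[R]_n -> V) : Prop :=
  exists2 L : R, 0 < L & forall x z, N (g x - g z) <= L * enorm (x - z).

Definition locally_lipschitz n (V : zmodType) (N : V -> R)
    (g : 'cV[R]_n -> V) : Prop :=
  forall r : R, 0 < r -> exists2 L : R, 0 < L &
    forall x z, enorm x <= r -> enorm z <= r ->
      N (g x - g z) <= L * enorm (x - z).

Lemma enorm_ge0 n (v : 'cV[R]_n) : 0 <= enorm v.
Proof. exact: sqrtr_ge0. Qed.

Lemma enormN n (v : 'cV[R]_n) : enorm (- v) = enorm v.
Proof. by congr Num.sqrt; apply: eq_bigr => i _; rewrite mxE sqrrN. Qed.

Lemma enorm0 n : enorm (0 : 'cV[R]_n) = 0.
Proof. by rewrite /enorm big1 ?sqrtr0// => i _; rewrite mxE expr0n. Qed.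

Lemma sqr_enorm n (v : 'cV[R]_n) : enorm v ^+ 2 = \sum_i v i 0 ^+ 2.
Proof. by rewrite sqr_sqrtr// sumr_ge0// => i _; rewrite sqr_ge0. Qed.

Lemma enorm_CS n (v w : 'cV[R]_n) :
  \sum_i v i 0 * w i 0 <= enorm v * enorm w.
Proof.
have sum0 (z : 'cV[R]_n) : enorm z = 0 -> forall i, z i 0 = 0.
  move=> z0 i; have /eqP := sqr_enorm z; rewrite z0 expr0n eq_sym psumr_eq0.
    by move=> /allP /(_ i (mem_index_enum _)) /=; rewrite sqrf_eq0 => /eqP.
  by move=> j _; rewrite sqr_ge0.
have [/sum0 v0|v0] := eqVneq (enorm v) 0.
  by rewrite big1 ?mulr_ge0 ?enorm_ge0// => i _; rewrite v0 mul0r.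
have [/sum0 w0|w0] := eqVneq (enorm w) 0.
  by rewrite big1 ?mulr_ge0 ?enorm_ge0// => i _; rewrite w0 mulr0.
have v_gt0 : 0 < enorm v by rewrite lt_neqAle eq_sym v0 enorm_ge0.
have w_gt0 : 0 < enorm w by rewrite lt_neqAle eq_sym w0 enorm_ge0.
have: 0 <= \sum_i (enorm w * v i 0 - enorm v * w i 0) ^+ 2.
  by apply: sumr_ge0 => i _; rewrite sqr_ge0.
have -> : \sum_i (enorm w * v i 0 - enorm v * w i 0) ^+ 2 =
    (enorm v * enorm w *+ 2) * (enorm v * enorm w - \sum_i v i 0 * w i 0).
  transitivity (enorm w ^+ 2 * (\sum_i v i 0 ^+ 2)
      + enorm v ^+ 2 * (\sum_i w i 0 ^+ 2)
      - (enorm v * enorm w *+ 2) * \sum_i v i 0 * w i 0).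
    rewrite !mulr_sumr -big_split -sumrB; apply: eq_bigr => i _ /=.
    by ring.
  by rewrite -!sqr_enorm; ring.
by rewrite pmulr_rge0 ?pmulrn_lgt0 ?mulr_gt0// subr_ge0.
Qed.

Lemma enormD n (v w : 'cV[R]_n) : enorm (v + w) <= enorm v + enorm w.
Proof.
rewrite -(@ler_pXn2r _ 2)// ?nnegrE ?addr_ge0 ?enorm_ge0// sqr_enorm sqrrD.
under eq_bigr do rewrite mxE sqrrD.
rewrite 2!big_split/= -!sqr_enorm lerD2r lerD2l sumrMnl lerMn2r/=.
exact: enorm_CS.
Qed.

End norms.

Arguments enorm {R n} v.
Arguments opnorm {R m n} A.

Section L2.
Context {R : realType}.
Local Notation mu := (@lebesgue_measure R).

Definition L2norm (T : R) n (g : R -> 'cV[R]_n) : \bar R :=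
  'N[mu]_(2%:E)[EFin \o ((fun t => enorm (g t)) \_ `[0, T])].

(* Representatives of the elements of L^2([0,T]; R^m): functions that agree
   almost everywhere on [0,T] are not identified but are at distance 0, so that
   a set is compact for the topology below iff its image in the quotient is. *)
Record L2 (T : R) (m : nat) := MkL2 {
  L2fun :> R -> 'cV[R]_m ;
  L2_measurable : forall i, measurable_fun `[0, T] (fun t => L2fun t i 0) ;
  L2_finite : (L2norm T L2fun < +oo)%E }.

HB.instance Definition _ T m := gen_eqMixin (L2 T m).
HB.instance Definition _ T m := gen_choiceMixin (L2 T m).

Section pseudometric.
Variables (T : R) (m : nat).
Implicit Types u v w : L2 T m.

Definition L2_ball u (e : R) : set (L2 T m) :=
  [set v | (L2norm T (fun t => u t - v t)%R < e%:E)%E].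

Let L2_ball_center u (e : R) : 0 < e -> L2_ball u e u.
Proof.
move=> e0; rewrite /L2_ball/= /L2norm.
rewrite (_ : _ \o _ = cst 0%E) ?Lnorm0 ?lte_fin//.
by apply/funext => t /=; rewrite patchE subrr enorm0; case: ifP.
Qed.

Let L2_ball_sym u v (e : R) : L2_ball u e v -> L2_ball v e u.
Proof.
rewrite /L2_ball/= /L2norm; congr ('N[_]__[_] < _)%E.
by apply/funext => t /=; rewrite !patchE -enormN opprB.
Qed.

Let measurable_enormB u v :
  measurable_fun setT ((fun t => enorm (u t - v t)) \_ `[0, T]).
Proof.
apply/(measurable_restrictT _ _).1 => //.
rewrite /enorm.
have ms : measurable_fun setT (Num.sqrt : R -> R).
  by apply: continuous_measurable_fun; exact: sqrt_continuous.
apply: (measurableT_comp ms); apply: measurable_sum => i; apply: measurable_funX.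
rewrite (_ : (fun _ => _) = (fun t => u t i 0 - v t i 0)); last first.
  by apply/funext => t; rewrite !mxE.
by apply: measurable_funB; exact: L2_measurable.
Qed.

Let L2_ball_triangle u v w (e1 e2 : R) :
  L2_ball u e1 v -> L2_ball v e2 w -> L2_ball u (e1 + e2) w.
Proof.
rewrite /L2_ball/= => uv vw; rewrite EFinD.
apply: le_lt_trans (lteD uv vw).
apply: le_trans (minkowski_EFin _ _ _ _);
  [|exact: measurable_enormB|exact: measurable_enormB|by rewrite ler1n].
rewrite /L2norm unlock; apply: gt0_ler_poweR; rewrite ?invr_ge0//.
- by rewrite in_itv/= leey andbT integral_ge0// => t _; rewrite poweR_ge0.
- by rewrite in_itv/= leey andbT integral_ge0// => t _; rewrite poweR_ge0.
have m2 (h : R -> R) : measurable_fun setT h ->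
    measurable_fun setT (fun t => (`|(h t)%:E| `^ 2%R)%E).
  move=> mh; apply: (measurableT_comp (measurable_poweR _)).
  by apply: measurableT_comp => //; exact/measurable_EFinP.
have m_uw := m2 _ (measurable_enormB u w).
have m_uvw := m2 _ (measurable_funD (measurable_enormB u v) (measurable_enormB v w)).
apply: ge0_le_integral => //; first by move=> t _; rewrite poweR_ge0.
move=> t _; rewrite gt0_ler_poweR ?in_itv/= ?leey ?lee_fin ?normr_ge0//.
rewrite !patchE; case: ifP => _; rewrite ?addr0//.
rewrite !ger0_norm ?addr_ge0 ?enorm_ge0//.
by rewrite (le_trans _ (enormD _ _))// subrKA.
Qed.

HB.instance Definition _ := hasNbhs.Build (L2 T m) (nbhs_ (entourage_ L2_ball)).

HB.instance Definition _ := Nbhs_isPseudoMetric.Build R (L2 T m)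
  erefl L2_ball_center L2_ball_sym L2_ball_triangle erefl.

End pseudometric.
End L2.

Section control_system.
Context {R : realType}.
Local Notation mu := (@lebesgue_measure R).

Definition vec_integral n (g : R -> 'cV[R]_n) (t : R) : 'cV[R]_n :=
  \col_i \int[mu]_(s in `[0, t]) (g s i 0).

Definition absolutely_continuous_on (a b : R) n (g : R -> 'cV[R]_n) : Prop :=
  forall e : R, 0 < e -> exists2 delta : R, 0 < delta &
    forall (N : nat) (I : nat -> R * R),
      (forall k, (k < N)%N -> a <= (I k).1 /\ (I k).1 <= (I k).2 /\ (I k).2 <= b) ->
      trivIset `I_N (fun k => `](I k).1, (I k).2[%classic) ->
      \sum_(k < N) ((I k).2 - (I k).1) < delta ->
      \sum_(k < N) enorm (g (I k).2 - g (I k).1) < e.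

Definition is_solution (T : R) d m (x0 : 'cV[R]_d) (f0 : 'cV[R]_d -> 'cV[R]_d)
    (f : 'cV[R]_d -> 'M[R]_(d, m)) (u : R -> 'cV[R]_m) (x : R -> 'cV[R]_d) :
    Prop :=
  absolutely_continuous_on 0 T x /\
  forall t, t \in `[0, T] ->
    x t = x0 + vec_integral (fun s => f0 (x s) + f (x s) *m u s) t.

Definition time_augmented m (u : R -> 'cV[R]_m) (t : R) : 'cV[R]_m.+1 :=
  col_mx (const_mx t : 'cV_1) (vec_integral u t).

End control_system.

Section riemann_stieltjes.
Context {R : realType}.
Implicit Types (f g : R -> R) (a b : R).

(* The partition is a = x_0 < s`_0 < s`_1 < ... = b and tau is its tagging. *)
Definition RS_sum f g a (s : seq R) (tau : nat -> R) : R :=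
  \sum_(i < size s) f (tau i) * (g s`_i - g (a :: s)`_i).

Definition is_RS_integral f g a b (v : R) : Prop :=
  forall e : R, 0 < e -> exists2 delta : R, 0 < delta &
    forall (s : seq R) (tau : nat -> R), itv_partition a b s ->
      (forall i, (i < size s)%N -> (a :: s)`_i <= tau i <= s`_i) ->
      (forall i, (i < size s)%N -> s`_i - (a :: s)`_i < delta) ->
      `|RS_sum f g a s tau - v| < e.

(* Set to 0 when the integral does not exist. *)
Definition RS_integral f g a b : R := xget 0 [set v | is_RS_integral f g a b v].

End riemann_stieltjes.

Section signature.
Context {R : realType}.

(* The product of the spaces R^(M^k) over all k. *)
Definition tensor_seq M := forall k : nat, 'cV[R]_(M ^ k).

(* X^(k+1)_{a,t} is the integral over [a,t] of X^(k)_{a,s} (x) dX(s).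
   [mxtens_unindex] is the indexing of Kronecker products used by [tensmx]:
   the entry of v (x) w at i is v_p * w_q where (p, q) = mxtens_unindex i. *)
Fixpoint iterated_integral M (X : R -> 'cV[R]_M) (a : R) (k : nat) (t : R) :
    'cV[R]_(M ^ k) :=
  match k return 'cV[R]_(M ^ k) with
  | 0 => const_mx 1
  | k'.+1 => \col_i
      let pq := mxtens_unindex (cast_ord (expnSr M k') i) in
      RS_integral (fun s => iterated_integral X a k' s pq.1 0)
                  (fun s => X s pq.2 0) a t
  end.

Definition signature M (X : R -> 'cV[R]_M) (a b : R) : tensor_seq M :=
  fun k => iterated_integral X a k b.

Definition Wspace M : set (tensor_seq M) :=
  [set l | finite_set [set k | l k != 0]].

(* For l in Wspace, at most finitely many of the summands are nonzero. *)
Definition pairing M (l S : tensor_seq M) : R :=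
  \sum_(k \in [set: nat]) \sum_(i < M ^ k) l k i 0 * S k i 0.

End signature.

(* Main.v *)
Require Import Defs.
From HB Require Import structures.
From mathcomp Require Import all_boot all_order all_algebra.
From mathcomp Require Import all_classical all_reals all_analysis.
From mathcomp Require Import measurable_realfun mxtens ring lra zify.

Import Order.TTheory GRing.Theory Num.Theory.
Import numFieldNormedType.Exports.

Local Open Scope classical_set_scope.
Local Open Scope ring_scope.

(** The functions of (time, control) of the form (t, u) |-> <l, S_{0,t}>, where S
    is the signature of the time-augmented primitive of u, form an algebra of
    continuous functions on the compact set [0,T] x K. The theorem is an instance
    of the Stone-Weierstrass theorem for this algebra, in a form
    ([stone_weierstrass]) that does not require the algebra to separate points:
    it suffices that the target function takes equal values at two points which
    no element of the algebra separates.

    The iterated Riemann-Stieltjes integrals are first rewritten as Lebesgue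
    integrals [word_integral] indexed by words ([iterated_integral_word]), since
    the paths involved are indefinite integrals of integrable densities
    ([is_RS_integral_density]). The algebra is closed under products because of
    the shuffle identity [word_integral_shuffle], which is iterated integration
    by parts; [Rintegral_by_parts] obtains the latter by telescoping two
    Riemann-Stieltjes sums.

    If all elements of the algebra agree at (t, u) and (s, v), the word with the
    single letter of time gives t = s. The words made of one spatial letter
    and time letters show that u - v has vanishing moments on [0,t], so that its
    primitive vanishes there ([moments_primitive_eq0], [signature_determines]).
    The state at time t depends only on that primitive ([solution_unique]),
    hence the outputs agree.

    Both this uniqueness and the joint continuity of the output
    ([continuous_output]) follow from a stability estimate for solutions,
    [solution_stable]. It is Gronwall's inequality with a weight
    const * (1 + |v|), which is only square-integrable ([gronwall_L2]). *)


(** * The Stone-Weierstrass theorem *)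

(** A property of sets that is inherited by subsets and finite unions and holds
    locally on a compact set holds on the compact set. *)
Lemma compact_local_ind (X : topologicalType) (K : set X) (P : set X -> Prop) :
  compact K -> P set0 ->
  (forall A B, A `<=` B -> P B -> P A) ->
  (forall A B, P A -> P B -> P (A `|` B)) ->
  (forall x, K x -> exists2 N, nbhs x N & P (K `&` N)) -> P K.
Proof.
move=> cK P0 Psub PU Ploc; apply: contrapT => nPK.
pose F : set_system X := [set S | P (K `\` S)].
have FF : ProperFilter F.
  apply: Build_ProperFilter_ex.
    move=> S FS; apply: contrapT => S0; apply: nPK.
    apply: Psub FS => x Kx; split=> // Sx; apply: S0; by exists x.
  split.
  - by rewrite /F/= setDT.
  - by move=> S S' FS FS'; rewrite /F/= setDIr; exact: PU.
  - by move=> S S' SS' FS; apply: Psub FS; exact: setDS.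
have [|x [Kx clx]] := cK F FF; first by rewrite /F/= setDv.
have [N Nx PN] := Ploc _ Kx.
have [|y [/= nNy Ny]] := clx (~` N) N _ Nx; last exact: nNy.
by rewrite /F/= setDE setCK.
Qed.

Section stone_weierstrass.
Context {R : realType} {X : topologicalType}.
Variable K : set X.
Implicit Types (A : set (X -> R)) (f g a : X -> R).

(** Membership in the uniform closure of [A] on [K]. *)
Definition approximable A g : Prop :=
  forall e : R, 0 < e -> exists2 a, A a & forall x, K x -> `|g x - a x| < e.

Lemma continuous_bounded_on (g : X -> R) : compact K ->
  {within K, continuous g} -> exists2 M, 0 < M & forall x, K x -> `|g x| <= M.
Proof.
move=> cK /subspace_continuousP cg.
apply: (compact_local_ind X K
  (fun S => exists2 M, 0 < M & forall x, S x -> `|g x| <= M)) => //.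
- by exists 1.
- by move=> S S' SS' [M M0 gM]; exists M => // x /SS'; exact: gM.
- move=> S S' [M M0 gM] [M' M'0 gM']; exists (M + M'); first exact: addr_gt0.
  move=> x [/gM|/gM'] /le_trans; apply; rewrite ?lerDl ?lerDr; exact: ltW.
- move=> x Kx; exists [set y | K y -> `|g x - g y| < 1].
    by have /cvgrPdist_lt /(_ 1 ltr01) := cg x Kx.
  exists (`|g x| + 1) => [|y [Ky /(_ Ky)/= gy]]; first by rewrite ltr_wpDl.
  rewrite (_ : g y = g x - (g x - g y)); last by ring.
  by rewrite (le_trans (ler_normB _ _))// lerD2l ltW.
Qed.

(** The iteration [q <- q + (y^2 - q^2) / 2] started at 0: it produces
    polynomials in [y] that increase to [|y|] uniformly on [-1, 1]. *)
Fixpoint abs_iter (n : nat) (y : R) : R :=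
  if n is k.+1 then abs_iter k y + 2^-1 * (y * y - abs_iter k y * abs_iter k y)
  else 0.

Lemma abs_iter_bound n (y : R) : `|y| <= 1 ->
  0 <= abs_iter n y <= `|y| /\
  `|y| - abs_iter n y <= `|y| * (1 - `|y| / 2) ^+ n.
Proof.
move=> y1; have y0 := normr_ge0 y; have yy : y * y = `|y| * `|y|.
  by rewrite -normrM ger0_norm// -expr2 sqr_ge0.
elim: n => [|n [/andP[q0 qy] qe]] /=; first by rewrite expr0 lexx y0; lra.
rewrite {}yy; move: (abs_iter n y) q0 qy qe => q q0 qy qe.
have e1 : `|y| - (q + 2^-1 * (`|y| * `|y| - q * q)) =
  (`|y| - q) * (1 - (`|y| + q) / 2) by field.
have h1 : 0 <= (`|y| - q) * (1 - (`|y| + q) / 2) by apply: mulr_ge0; lra.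
have h2 : (`|y| - q) * (1 - (`|y| + q) / 2) <= (`|y| - q) * (1 - `|y| / 2).
  by apply: ler_wpM2l; lra.
have h3 : (`|y| - q) * (1 - `|y| / 2) <= `|y| * (1 - `|y| / 2) ^+ n.+1.
  by rewrite exprSr mulrA; apply: ler_wpM2r => //; lra.
have h4 : 0 <= (`|y| - q) * (`|y| + q) by apply: mulr_ge0; lra.
split; last by rewrite e1 (le_trans h2 h3).
by apply/andP; split; nra.
Qed.

Lemma abs_iter_cvg (e : R) : 0 < e -> exists n, forall y, `|y| <= 1 ->
  `| `|y| - abs_iter n y| < e.
Proof.
move=> e0; have [n ne] : exists n, 2 / e < n.+1%:R.
  exists (Num.truncn (2 / e)); exact: truncnS_gt.
exists n.+1 => y y1.
have [/andP[q0 qy] qe] := abs_iter_bound n.+1 y y1.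
rewrite ger0_norm ?subr_ge0//; apply: le_lt_trans qe _.
have y0 := normr_ge0 y; set z := `|y| / 2.
have -> : `|y| = 2 * z by rewrite /z mulrC divfK.
have z0 : 0 <= z by apply: divr_ge0.
have z1 : z <= 1 by rewrite /z; lra.
(* Bernoulli: (1 - z)^N (1 + N z) <= (1 - z^2)^N <= 1 *)
have bern : (1 - z) ^+ n.+1 * (1 + n.+1%:R * z) <= 1.
  have b1 : 1 + n.+1%:R * z <= (1 + z) ^+ n.+1.
    elim: n.+1 => [|k IH]; first by rewrite mul0r addr0 expr0.
    rewrite exprS -natr1.
    have : (1 + z) * (1 + k%:R * z) <= (1 + z) * (1 + z) ^+ k.
      by apply: ler_wpM2l => //; lra.
    have : 0 <= k%:R * z * z by rewrite !mulr_ge0.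
    lra.
  apply: (@le_trans _ _ ((1 - z) ^+ n.+1 * (1 + z) ^+ n.+1)).
    by apply: ler_wpM2l => //; apply: exprn_ge0; lra.
  rewrite -exprMn; apply: exprn_ile1; nra.
have n0 : 0 < n.+1%:R :> R by [].
have e2 : 2 < e * n.+1%:R by rewrite mulrC -ltr_pdivrMr.
set w := (1 - z) ^+ n.+1 in bern *.
have w0 : 0 <= w by apply: exprn_ge0; lra.
rewrite -(@ltr_pM2r _ n.+1%:R)//; apply: le_lt_trans e2.
nra.
Qed.

Variable A : set (X -> R).
Hypothesis cK : compact K.
Hypothesis A1 : A (cst 1).
Hypothesis AD : forall a b, A a -> A b -> A (a \+ b).
Hypothesis AZ : forall (k : R) a, A a -> A (k \*o a).
Hypothesis AM : forall a b, A a -> A b -> A (a \* b).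
Hypothesis Acont : forall a, A a -> {within K, continuous a}.

Let approx := approximable A.

Lemma approximable_sub g : A g -> approx g.
Proof. by move=> Ag e e0; exists g => // x _; rewrite subrr normr0. Qed.

Lemma approximableD f g : approx f -> approx g -> approx (f \+ g).
Proof.
move=> af ag e e0; have e2 : 0 < e / 2 by rewrite divr_gt0.
have [a Aa fa] := af _ e2; have [b Ab gb] := ag _ e2.
exists (a \+ b); first exact: AD.
move=> x Kx /=; rewrite opprD addrACA (le_lt_trans (ler_normD _ _))//.
by rewrite [ltRHS]splitr ltrD ?fa ?gb.
Qed.

Lemma approximableZ (k : R) g : approx g -> approx (k \*o g).
Proof.
move=> ag e e0; have k0 : 0 < `|k| + 1 by rewrite ltr_wpDl.
have [a Aa ga] := ag (e / (`|k| + 1)) (divr_gt0 e0 k0).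
exists (k \*o a); first exact: AZ.
move=> x Kx /=; rewrite -mulrBr normrM.
apply: (@le_lt_trans _ _ ((`|k| + 1) * `|g x - a x|)).
  by rewrite ler_wpM2r// lerDl.
by rewrite mulrC -ltr_pdivlMr// ga.
Qed.

Lemma approximable_norm g : approx g -> approx (fun x => `|g x|).
Proof.
move=> ag e e0; have e2 : 0 < e / 2 by rewrite divr_gt0.
have [a Aa ga] := ag _ e2.
have [M M0 aM] := continuous_bounded_on a cK (Acont _ Aa).
have [n pn] := abs_iter_cvg (e / 2 / M) (divr_gt0 e2 M0).
have Ap k : A (fun x => abs_iter k (M^-1 * a x)).
  elim: k => [|k IH] /=.
    rewrite (_ : (fun _ => _) = 0 \*o cst 1); first exact: AZ.
    by apply/funext => x /=; rewrite mul0r.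
  rewrite (_ : (fun _ => _) = (fun x => abs_iter k (M^-1 * a x)) \+
     2^-1 \*o ((M^-1 \*o a) \* (M^-1 \*o a) \+ (-1) \*o
      ((fun x => abs_iter k (M^-1 * a x)) \* (fun x => abs_iter k (M^-1 * a x))))).
    by apply: AD => //; apply: AZ; apply: AD; [|apply: AZ]; apply: AM => //; apply: AZ.
  by apply/funext => x /=; rewrite mulN1r.
exists (M \*o (fun x => abs_iter n (M^-1 * a x))); first exact: AZ.
move=> x Kx /=; rewrite [X in `|X|](_ : _ = (`|g x| - `|a x|) +
  (`|a x| - M * abs_iter n (M^-1 * a x))); last by ring.
rewrite (le_lt_trans (ler_normD _ _))// [ltRHS]splitr ltrD//.
  by rewrite (le_lt_trans (ler_dist_dist _ _))// ga.
have M'0 : M != 0 by rewrite gt_eqF.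
have -> : `|a x| - M * abs_iter n (M^-1 * a x) =
    M * (`|M^-1 * a x| - abs_iter n (M^-1 * a x)).
  by rewrite mulrBr normrM gtr0_norm ?invr_gt0// mulrA divff// mul1r.
rewrite normrM gtr0_norm// mulrC -ltr_pdivlMr//; apply: pn.
by rewrite normrM gtr0_norm ?invr_gt0// mulrC ler_pdivrMr// mul1r aM.
Qed.

Let approx_max f g : approx f -> approx g -> approx (f \max g).
Proof.
move=> af ag; rewrite (_ : f \max g =
  2^-1 \*o (f \+ g \+ (fun x => `|(f \+ (-1) \*o g) x|))).
  apply: approximableZ; apply: approximableD; first exact: approximableD.
  by apply/approximable_norm/approximableD => //; exact: approximableZ.
apply/funext => x /=; rewrite mulN1r maxr_absE mulrC; congr (_ * _).
Qed.

Let approx_min f g : approx f -> approx g -> approx (f \min g).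
Proof.
move=> af ag; rewrite (_ : f \min g =
   (-1) \*o ((-1) \*o f \max (-1) \*o g)).
  by apply/approximableZ/approx_max; exact: approximableZ.
by apply/funext => x /=; rewrite !mulN1r -oppr_min opprK.
Qed.

Let approx_cont g : approx g -> {within K, continuous g}.
Proof.
move=> ag; apply/subspace_continuousP => x Kx; apply/cvgrPdist_lt => e e0.
have e3 : 0 < e / 3 by rewrite divr_gt0.
have [a Aa ga] := ag _ e3.
have /subspace_continuousP /(_ x Kx) /cvgrPdist_lt /(_ _ e3) ac := Acont _ Aa.
rewrite !near_withinE in ac *; near=> y => Ky.
have /(_ Ky) axy : K y -> `|a x - a y| < e / 3 by near: y.
have := ga _ Kx; have := ga _ Ky; rewrite !ltr_norml in axy *.
move=> /andP[? ?] /andP[? ?]; move: axy => /andP[? ?].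
suff : - e < g x - g y < e by [].
by apply/andP; split; lra.
Unshelve. all: by end_near. Qed.

(** Separation is only demanded of the points on which [f] differs. *)
Theorem stone_weierstrass f : {within K, continuous f} ->
  (forall x y, K x -> K y -> (forall a, A a -> a x = a y) -> f x = f y) ->
  approximable A f.
Proof.
move=> /subspace_continuousP cf sepf e1 e10.
(* Half of the error goes to a lattice combination [g] of the algebra, the
   other half to approximating [g] itself. *)
have [e e0 ->] : exists2 e, 0 < e & e1 = e + e.
  by exists (e1 / 2); [rewrite divr_gt0|exact: splitr].
have [K0|[x0 Kx0]] : ~ (exists x, K x) \/ exists x, K x by have [|] := pselect (exists x, K x); [right|left].
  by exists (cst 1) => // x Kx; exfalso; apply: K0; exists x.
have interp x y : K x -> K y -> exists2 a, A a & a x = f x /\ a y = f y.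
  move=> Kx Ky; have [sep|nsep] := pselect (exists2 b, A b & b x != b y).
    have [b Ab bxy] := sep; pose k := (f y - f x) / (b y - b x).
    exists ((f x - k * b x) \*o cst 1 \+ k \*o b).
      by apply: AD; exact: AZ.
    split=> /=; first by rewrite mulr1 subrK.
    have : k * (b y - b x) = f y - f x by rewrite divfK// subr_eq0 eq_sym.
    by rewrite mulr1 mulrBr; lra.
  exists (f x \*o cst 1); first exact: AZ.
  split; rewrite /= mulr1//; apply: sepf => // a Aa.
  by apply/eqP/negP => /negP axy; apply: nsep; exists a.
have below x : K x -> exists2 g, approx g & g x = f x /\
    forall z, K z -> g z < f z + e.
  move=> Kx; apply: (compact_local_ind X K (fun S => exists2 g, approx g &
    g x = f x /\ forall z, S z -> g z < f z + e)) => //.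
  - have [a Aa [ax _]] := interp x x Kx Kx.
    by exists a; [exact: approximable_sub|].
  - by move=> S S' SS' [g ag [gx gf]]; exists g => //; split=> // z /SS'; exact: gf.
  - move=> S S' [g ag [gx gf]] [h ah [hx hf]]; exists (g \min h).
      exact: approx_min.
    split; first by rewrite /= gx hx minxx.
    by move=> z [/gf|/hf] ?; rewrite gt_min; apply/orP; [left|right].
  - move=> y Ky; have [a Aa [ax ay]] := interp x y Kx Ky.
    exists [set z | K z -> a z < f z + e]; last first.
      exists a; first exact: approximable_sub.
      by split=> // z [Kz /(_ Kz)].
    have e2 : 0 < e / 2 by rewrite divr_gt0.
    have /subspace_continuousP /(_ y Ky) /cvgrPdist_lt /(_ _ e2) := Acont _ Aa.
    have /cvgrPdist_lt /(_ _ e2) := cf y Ky.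
    rewrite !near_withinE => fy ay'; near=> z => Kz.
    have /(_ Kz) : K z -> `|f y - f z| < e / 2 by near: z.
    have /(_ Kz) : K z -> `|a y - a z| < e / 2 by near: z.
    rewrite ay !ltr_norml => /andP[? ?] /andP[? ?].
    suff : a z < f z + e by []; lra.
have [g ag [gf fg]] : exists2 g, approx g & (forall z, K z -> g z < f z + e) /\
    forall z, K z -> f z - e < g z.
  apply: (compact_local_ind X K (fun S => exists2 g, approx g &
    (forall z, K z -> g z < f z + e) /\ forall z, S z -> f z - e < g z)) => //.
  - by have [g ag [_ gf]] := below x0 Kx0; exists g.
  - by move=> S S' SS' [g ag [gf fg]]; exists g => //; split=> // z /SS'; exact: fg.
  - move=> S S' [g ag [gf fg]] [h ah [hf fh]]; exists (g \max h).
      exact: approx_max.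
    split=> z; first by move=> Kz; rewrite gt_max gf// hf.
    by move=> [/fg|/fh] ?; rewrite lt_max; apply/orP; [left|right].
  - move=> x Kx; have [g ag [gx gf]] := below x Kx.
    exists [set z | K z -> f z - e < g z]; last first.
      by exists g => //; split=> // z [Kz /(_ Kz)].
    have e2 : 0 < e / 2 by rewrite divr_gt0.
    have /subspace_continuousP /(_ x Kx) /cvgrPdist_lt /(_ _ e2) := approx_cont _ ag.
    have /cvgrPdist_lt /(_ _ e2) := cf x Kx.
    rewrite !near_withinE => fx gx'; near=> z => Kz.
    have /(_ Kz) : K z -> `|f x - f z| < e / 2 by near: z.
    have /(_ Kz) : K z -> `|g x - g z| < e / 2 by near: z.
    rewrite gx !ltr_norml => /andP[? ?] /andP[? ?].
    suff : f z - e < g z by []; lra.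
have [a Aa ga] := ag e e0; exists a => // x Kx.
have := ga x Kx; rewrite !ltr_norml => /andP[? ?].
have := gf x Kx; have := fg x Kx; move=> ? ?.
suff : - (e + e) < f x - a x < e + e by [].
by apply/andP; split; lra.
Unshelve. all: by end_near. Qed.
End stone_weierstrass.

(** * Riemann-Stieltjes integrals against indefinite integrals *)

Section real_integrable.
Context {d : measure_display} {T : measurableType d} {R : realType}.
Variables (mu : {measure set T -> \bar R}) (D : set T).
Implicit Types (g h : T -> R).

Lemma integrable_scale (k : R) h : d.-measurable D ->
  mu.-integrable D (EFin \o h) -> mu.-integrable D (EFin \o (fun x => k * h x)).
Proof.
move=> mD ih; have := integrableZl mD k ih.
by apply: eq_integrable => // x _ /=; rewrite EFinM.
Qed.

Lemma integrable_add h g : d.-measurable D ->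
  mu.-integrable D (EFin \o h) -> mu.-integrable D (EFin \o g) ->
  mu.-integrable D (EFin \o (fun x => h x + g x)).
Proof.
move=> mD ih ig; have := integrableD mD ih ig.
by apply: eq_integrable => // x _ /=; rewrite EFinD.
Qed.

Lemma integrable_sub h g : d.-measurable D ->
  mu.-integrable D (EFin \o h) -> mu.-integrable D (EFin \o g) ->
  mu.-integrable D (EFin \o (fun x => h x - g x)).
Proof.
move=> mD ih ig; have := integrableB mD ih ig.
by apply: eq_integrable => // x _ /=; rewrite EFinB.
Qed.

Lemma integrable_sum_real (n : nat) (h : 'I_n -> T -> R) :
  d.-measurable D -> (forall i, mu.-integrable D (EFin \o h i)) ->
  mu.-integrable D (EFin \o (fun x => \sum_i h i x)).
Proof.
move=> mD ih.
have := integrable_sum mD (index_enum 'I_n) (P := xpredT) (fun i _ => ih i).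
by apply: eq_integrable => // x _ /=; rewrite sumEFin.
Qed.

End real_integrable.

Section segment_integrals.
Context {R : realType}.
Local Notation mu := (@lebesgue_measure R).
Implicit Types (F G f g h : R -> R) (a b r s : R).

Lemma segment_subset a b r s : a <= r -> s <= b -> `[r, s] `<=` `[a, b].
Proof.
move=> ar sb x /=; rewrite !in_itv/= => /andP[rx xs].
by rewrite (le_trans ar rx) (le_trans xs sb).
Qed.

Lemma integrable_segmentS h a b r s : a <= r -> s <= b ->
  mu.-integrable `[a, b] (EFin \o h) -> mu.-integrable `[r, s] (EFin \o h).
Proof. by move=> ar sb; apply: integrableS => //; exact: segment_subset. Qed.

Lemma continuous_segmentS F a b r s : a <= r -> s <= b ->
  {within `[a, b], continuous F} -> {within `[r, s], continuous F}.
Proof. by move=> ar sb; apply: continuous_subspaceW; exact: segment_subset. Qed.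

Lemma continuous_integrableM F h a b : {within `[a, b], continuous F} ->
  mu.-integrable `[a, b] (EFin \o h) ->
  mu.-integrable `[a, b] (EFin \o (fun s => F s * h s)).
Proof.
move=> cF ih.
have := @integrableMr _ _ _ mu `[a, b] _ F (EFin \o h).
apply => //; first exact: subspace_continuous_measurable_fun.
have [M M0 FM] := continuous_bounded_on `[a, b] F (@segment_compact _ a b) cF.
exists M; split; first exact: num_real.
by move=> y My x abx; apply: le_trans (FM x abx) _; exact: ltW.
Qed.

Lemma continuous_integrable_segment F a b : {within `[a, b], continuous F} ->
  mu.-integrable `[a, b] (EFin \o F).
Proof. by apply: continuous_compact_integrable; exact: segment_compact. Qed.

Lemma Rintegral_segmentB h a b r s : a <= r -> r <= s -> s <= b ->
  mu.-integrable `[a, b] (EFin \o h) ->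
  \int[mu]_(x in `[a, s]) h x - \int[mu]_(x in `[a, r]) h x =
  \int[mu]_(x in `[r, s]) h x.
Proof.
move=> ar rs sb ih; rewrite Rintegral_itvB ?bnd_simp//; last first.
  exact: integrable_segmentS ih.
rewrite Rintegral_itv_obnd_cbnd//; apply: integrableS ih => //.
by move=> x /=; rewrite !in_itv/= => /andP[? ?]; apply/andP; split; lra.
Qed.

Lemma uniformly_continuous_segment F a b : {within `[a, b], continuous F} ->
  forall e, 0 < e -> exists2 delta, 0 < delta & forall x y, x \in `[a, b] ->
    y \in `[a, b] -> `|x - y| < delta -> `|F x - F y| < e.
Proof.
move=> /subspace_continuousP cF e e0.
have [||||d d0 dF] := compact_local_ind R `[a, b]
  (fun S => exists2 delta, 0 < delta & forall x y, S x -> x \in `[a, b] ->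
    y \in `[a, b] -> `|x - y| < delta -> `|F x - F y| < e)
  (@segment_compact _ a b).
- by exists 1.
- move=> S S' SS' [d d0 dF]; exists d => // x y /SS'; exact: dF.
- move=> S S' [d d0 dF] [d' d'0 dF']; exists (Num.min d d').
    by rewrite lt_min d0.
  by move=> x y [Sx|Sx] xab yab; rewrite lt_min => /andP[? ?]; [exact: dF|exact: dF'].
- move=> x abx; have e2 : 0 < e / 2 by rewrite divr_gt0.
  have /cvgrPdist_lt /(_ _ e2) := cF x abx.
  rewrite near_withinE => /nbhs_ballP[d /= d0 dF].
  have d2 : 0 < d / 2 by rewrite divr_gt0.
  exists (ball x (d / 2)); first exact: nbhsx_ballx.
  exists (d / 2) => // y z [_ xy] yab zab yz.
  have xy' : `|x - y| < d / 2 by [].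
  have Fy : `|F x - F y| < e / 2.
    by apply: dF => //; rewrite /ball/=; move: xy' d2; lra.
  have Fz : `|F x - F z| < e / 2.
    apply: dF => //; rewrite /ball/= (_ : x - z = (x - y) + (y - z)); last by ring.
    by rewrite (le_lt_trans (ler_normD _ _))// [ltRHS]splitr ltrD.
  rewrite (_ : F y - F z = (F x - F z) - (F x - F y)); last by ring.
  by rewrite (le_lt_trans (ler_normB _ _))// [ltRHS]splitr ltrD.
by exists d => // x y xab yab; exact: dF.
Qed.

Lemma partition_bounds a b (s : seq R) i : itv_partition a b s ->
  (i < size s)%N -> [/\ a <= (a :: s)`_i, (a :: s)`_i < s`_i & s`_i <= b].
Proof.
move=> abs si; have [pas _] := abs; split.
- by rewrite (set_nth_default b) ?itv_partition_nth_ge//= ltnS ltnW.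
- by have /(pathP 0) := pas; exact.
- have := itv_partition_nth_le (m := i.+1) _ abs => /(_ si) /=.
  by rewrite (set_nth_default 0).
Qed.

Lemma partition_telescope G a b (s : seq R) : itv_partition a b s ->
  \sum_(i < size s) (G s`_i - G (a :: s)`_i) = G b - G a.
Proof.
move=> [_ /eqP <-]; elim: s a => [|x s IH] a /=; first by rewrite big_ord0 subrr.
by rewrite big_ord_recl/= IH; ring.
Qed.

Lemma fine_partition a b delta : a <= b -> 0 < delta -> exists2 s : seq R,
  itv_partition a b s &
  forall i, (i < size s)%N -> s`_i - (a :: s)`_i < delta.
Proof.
rewrite le_eqVlt => /predU1P[->|ab] d0; first by exists [::].
have [n nd] : exists n, (b - a) / delta < n.+1%:R.
  by exists (Num.truncn ((b - a) / delta)); exact: truncnS_gt.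
pose k := (b - a) / n.+1%:R.
have k0 : 0 < k by rewrite divr_gt0// subr_gt0.
have kd : k < delta by rewrite /k ltr_pdivrMr// mulrC -ltr_pdivrMr.
pose x (i : nat) := a + i%:R * k.
have x0 : a = x 0%N by rewrite /x mul0r addr0.
have xE i : (i < n.+1)%N -> (mkseq (fun i => x i.+1) n.+1)`_i = x i.+1.
  by move=> ni; rewrite nth_mkseq.
have xE' i : (i < n.+1)%N -> (a :: mkseq (fun i => x i.+1) n.+1)`_i = x i.
  by case: i => [|i] ni //=; rewrite xE// ltnW.
have xS i : x i.+1 = x i + k by rewrite /x -natr1; ring.
exists (mkseq (fun i => x i.+1) n.+1); last first.
  by move=> i; rewrite size_mkseq => ni; rewrite xE// xE'// xS; lra.
split.
  by apply/(pathP 0) => i; rewrite size_mkseq => ni; rewrite xE// xE'// xS ltrDl.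
rewrite (last_nth 0) size_mkseq /= nth_mkseq// /x /k mulrCA divff ?mulr1//.
by rewrite subrKC.
Qed.

(** Uniqueness rests on the existence of partitions of arbitrarily small mesh. *)
Lemma is_RS_integral_unique F G a b (v w : R) : a <= b ->
  is_RS_integral F G a b v -> is_RS_integral F G a b w -> v = w.
Proof.
move=> ab Iv Iw; apply/eqP; rewrite -subr_eq0; apply/negPn/negP => vw.
have e0 : 0 < `|v - w| / 2 by rewrite divr_gt0// normr_gt0.
have [d d0 dv] := Iv _ e0; have [d' d'0 dw] := Iw _ e0.
have dd : 0 < Num.min d d' by rewrite lt_min d0.
have [s abs sd] := fine_partition a b _ ab dd.
pose tau i := s`_i.
have tauP i : (i < size s)%N -> (a :: s)`_i <= tau i <= s`_i.
  by move=> si; have [_ /ltW -> _] := partition_bounds _ _ _ _ abs si; rewrite lexx.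
have {dv} := dv s tau abs tauP; have {dw} := dw s tau abs tauP.
move=> dw dv.
have : `|v - w| < `|v - w|; last by rewrite ltxx.
rewrite [ltRHS]splitr.
rewrite [X in `|X| < _](_ : _ = (RS_sum F G a s tau - w) - (RS_sum F G a s tau - v)).
  rewrite (le_lt_trans (ler_normB _ _))// ltrD//.
    by apply: dw => i /sd; rewrite lt_min => /andP[].
  by apply: dv => i /sd; rewrite lt_min => /andP[].
by ring.
Qed.

(** Each increment of [G] is the integral of [h], and [F] hardly varies on a
    cell of a fine partition. *)
Lemma is_RS_integral_density F G h a b : a <= b ->
  {within `[a, b], continuous F} ->
  mu.-integrable `[a, b] (EFin \o h) ->
  (forall s, s \in `[a, b] -> G s = \int[mu]_(x in `[a, s]) h x) ->
  is_RS_integral F G a b (\int[mu]_(x in `[a, b]) (F x * h x)).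
Proof.
move=> ab cF ih Gh e e0.
have inh : mu.-integrable `[a, b] (EFin \o (fun x => `|h x|)).
  exact: integrable_norm.
have iFh := continuous_integrableM _ _ _ _ cF ih.
pose H := \int[mu]_(x in `[a, b]) `|h x|.
have H0 : 0 <= H by exact: Rintegral_ge0.
have H1 : 0 < H + 1 by rewrite ltr_wpDl.
have [d d0 dF] := uniformly_continuous_segment _ _ _ cF _ (divr_gt0 e0 H1).
exists d => // s tau abs tauP sd.
rewrite -[X in _ - X](_ : \sum_(i < size s)
    \int[mu]_(x in `[(a :: s)`_i, s`_i]) (F x * h x) = _); last first.
  transitivity (\sum_(i < size s) (\int[mu]_(x in `[a, s`_i]) (F x * h x) -
      \int[mu]_(x in `[a, (a :: s)`_i]) (F x * h x))).
    apply: eq_bigr => i _.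
    have [ai lt_i ib] := partition_bounds _ _ _ _ abs (ltn_ord i).
    by rewrite (Rintegral_segmentB _ a b)// ltW.
  rewrite (partition_telescope
    (fun y => \int[mu]_(x in `[a, y]) (F x * h x)) _ _ _ abs).
  by rewrite set_itv1 Rintegral_set1 subr0.
rewrite -sumrB (le_lt_trans (ler_norm_sum _ _ _))//.
apply: (@le_lt_trans _ _ (\sum_(i < size s)
   (e / (H + 1)) * \int[mu]_(x in `[(a :: s)`_i, s`_i]) `|h x|)).
  apply: ler_sum => i _.
  have [ai lt_i ib] := partition_bounds _ _ _ _ abs (ltn_ord i).
  have /andP[ti1 ti2] := tauP _ (ltn_ord i).
  have iFhi := integrable_segmentS _ _ _ _ _ ai ib iFh.
  have ihi := integrable_segmentS _ _ _ _ _ ai ib ih.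
  have inhi := integrable_segmentS _ _ _ _ _ ai ib inh.
  have iFthi : mu.-integrable `[(a :: s)`_i, s`_i]
     (EFin \o (fun x => F (tau i) * h x)) by exact: integrable_scale.
  have iD : mu.-integrable `[(a :: s)`_i, s`_i]
     (EFin \o (fun x => F (tau i) * h x - F x * h x)).
    exact: integrable_sub.
  rewrite !Gh ?in_itv/=; last 2 first.
  - by rewrite ai (le_trans _ ib)// ltW.
  - by rewrite ib (le_trans ai)// ltW.
  rewrite (Rintegral_segmentB _ a b)//; last exact: ltW.
  rewrite -RintegralZl// -RintegralB//.
  rewrite (le_trans (le_normr_Rintegral _ _))// -RintegralZl//.
  apply: le_Rintegral => //; first exact: integrable_norm.
    exact: integrable_scale.
  move=> x /=; rewrite in_itv/= => /andP[x1 x2].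
  rewrite -mulrBl normrM ler_wpM2r// ltW// dF// ?in_itv/=.
  - by rewrite (le_trans ai ti1) (le_trans ti2 ib).
  - by rewrite (le_trans ai x1) (le_trans x2 ib).
  - by have := sd i (ltn_ord i); rewrite ltr_norml => ?; apply/andP; split; lra.
rewrite -mulr_sumr [X in _ * X](_ : _ = H); last first.
  transitivity (\sum_(i < size s) (\int[mu]_(x in `[a, s`_i]) `|h x| -
      \int[mu]_(x in `[a, (a :: s)`_i]) `|h x|)).
    apply: eq_bigr => i _.
    have [ai lt_i ib] := partition_bounds _ _ _ _ abs (ltn_ord i).
    by rewrite (Rintegral_segmentB _ a b)// ltW.
  rewrite (partition_telescope
    (fun y => \int[mu]_(x in `[a, y]) `|h x|) _ _ _ abs).
  by rewrite set_itv1 Rintegral_set1 subr0.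
by rewrite mulrAC ltr_pdivrMr// ltr_pM2l// ltrDl.
Qed.

Lemma RS_integral_density F G h a b : a <= b ->
  {within `[a, b], continuous F} ->
  mu.-integrable `[a, b] (EFin \o h) ->
  (forall s, s \in `[a, b] -> G s = \int[mu]_(x in `[a, s]) h x) ->
  RS_integral F G a b = \int[mu]_(x in `[a, b]) (F x * h x).
Proof.
move=> ab cF ih Gh; apply: xget_unique.
  exact: is_RS_integral_density.
move=> v Iv; apply: (is_RS_integral_unique F G a b) => //.
exact: is_RS_integral_density.
Qed.

Lemma continuous_indefinite_integral h a b : a <= b ->
  mu.-integrable `[a, b] (EFin \o h) ->
  {within `[a, b], continuous (fun s => \int[mu]_(x in `[a, s]) h x)}.
Proof. exact: parameterized_integral_continuous. Qed.

(** Integration by parts for indefinite integrals: tag the cells of a partition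
    by their right ends in one Riemann-Stieltjes sum and by their left ends in
    the other; the two sums then telescope. *)
Lemma Rintegral_by_parts f g a b : a <= b ->
  mu.-integrable `[a, b] (EFin \o f) -> mu.-integrable `[a, b] (EFin \o g) ->
  (\int[mu]_(x in `[a, b]) f x) * (\int[mu]_(x in `[a, b]) g x) =
  \int[mu]_(s in `[a, b]) ((\int[mu]_(x in `[a, s]) f x) * g s) +
  \int[mu]_(s in `[a, b]) ((\int[mu]_(x in `[a, s]) g x) * f s).
Proof.
move=> ab iF ig.
pose F s := \int[mu]_(x in `[a, s]) f x; pose G s := \int[mu]_(x in `[a, s]) g x.
have cF := continuous_indefinite_integral _ _ _ ab iF.
have cG := continuous_indefinite_integral _ _ _ ab ig.
have IF := is_RS_integral_density F G g a b ab cF ig (fun s _ => erefl).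
have IG := is_RS_integral_density G F f a b ab cG iF (fun s _ => erefl).
rewrite -/(F b) -/(G b); set I := (X in _ = X + _); set J := (X in _ = _ + X).
apply/eqP; rewrite -subr_eq0; apply/negPn/negP => FG.
have e0 : 0 < `|F b * G b - (I + J)| / 2 by rewrite divr_gt0// normr_gt0.
have [d d0 dI] := IF _ e0; have [d' d'0 dJ] := IG _ e0.
have dd : 0 < Num.min d d' by rewrite lt_min d0.
have [s abs sd] := fine_partition a b _ ab dd.
have lt_i i : (i < size s)%N -> (a :: s)`_i <= s`_i.
  by move=> si; have [_ /ltW -> _] := partition_bounds _ _ _ _ abs si.
have /dI : forall i, (i < size s)%N -> (a :: s)`_i <= (fun i => s`_i) i <= s`_i.
  by move=> i si; rewrite lexx andbT lt_i.
have /dJ : forall i, (i < size s)%N ->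
    (a :: s)`_i <= (fun i => (a :: s)`_i) i <= s`_i.
  by move=> i si; rewrite lexx lt_i.
move=> {}dJ {}dI.
have {}dI : `|RS_sum F G a s (fun i => s`_i) - I| < `|F b * G b - (I + J)| / 2.
  by apply: dI => // i /sd; rewrite lt_min => /andP[].
have {}dJ : `|RS_sum G F a s (fun i => (a :: s)`_i) - J| < `|F b * G b - (I + J)| / 2.
  by apply: dJ => // i /sd; rewrite lt_min => /andP[].
have : `|F b * G b - (I + J)| < `|F b * G b - (I + J)|; last by rewrite ltxx.
rewrite [ltRHS]splitr; apply: le_lt_trans (ltrD dI dJ).
rewrite [X in `|X| <= _](_ : _ = (RS_sum F G a s (fun i => s`_i) - I) +
   (RS_sum G F a s (fun i => (a :: s)`_i) - J)); first exact: ler_normD.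
have -> : F b * G b = RS_sum F G a s (fun i => s`_i) +
    RS_sum G F a s (fun i => (a :: s)`_i); last by ring.
rewrite /RS_sum -big_split/=.
transitivity (\sum_(i < size s) ((F \* G) s`_i - (F \* G) (a :: s)`_i)).
  rewrite (partition_telescope _ _ _ _ abs)/=.
  by rewrite {3}/F set_itv1 Rintegral_set1 mul0r subr0.
by apply: eq_bigr => i _ /=; ring.
Qed.

End segment_integrals.

(** * Signatures, words and the shuffle product *)

(** All interleavings of two words, counted with multiplicity. *)
Fixpoint shuffle {I : Type} (v : seq I) : seq I -> seq (seq I) :=
  if v is a :: v' then
    fix shuffle_v w := if w is b :: w' then
        map (cons a) (shuffle v' w) ++ map (cons b) (shuffle_v w')
      else [:: v]
  else fun w => [:: w].

Section word_integrals.
Context {R : realType}.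
Local Notation mu := (@lebesgue_measure R).

(** The iterated integral of the densities [h j] along a word; the outermost
    integration is that of the head of the word. *)
Fixpoint word_integral M (h : 'I_M -> R -> R) (w : seq 'I_M) (t : R) : R :=
  if w is j :: w' then
    \int[mu]_(s in `[0, t]) (word_integral M h w' s * h j s)
  else 1.

Variables (T : R) (M : nat) (h : 'I_M -> R -> R).
Hypothesis T0 : 0 <= T.
Hypothesis ih : forall j, mu.-integrable `[0, T] (EFin \o h j).
Local Notation W := (word_integral M h).

Lemma continuous_word_integral w : {within `[0, T], continuous (W w)}.
Proof.
elim: w => [|j w IH] /=.
  by apply: continuous_subspaceT => x; exact: cvg_cst.
by apply: continuous_indefinite_integral => //; exact: continuous_integrableM.
Qed.

Lemma integrable_word_integralM w j t : t <= T ->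
  mu.-integrable `[0, t] (EFin \o (fun s => W w s * h j s)).
Proof.
move=> tT; apply: (integrable_segmentS _ 0 T) => //.
by apply: continuous_integrableM => //; exact: continuous_word_integral.
Qed.

Lemma sum_word_integral_cons (l : seq (seq 'I_M)) j t : t <= T ->
  \sum_(w <- map (cons j) l) W w t =
  \int[mu]_(s in `[0, t]) ((\sum_(w <- l) W w s) * h j s).
Proof.
move=> tT.
suff [] : mu.-integrable `[0, t] (EFin \o (fun s => (\sum_(w <- l) W w s) * h j s)) /\
  \sum_(w <- map (cons j) l) W w t =
  \int[mu]_(s in `[0, t]) ((\sum_(w <- l) W w s) * h j s) by [].
elim: l => [|w l [iIH IH]] /=.
  rewrite big_nil; under [X in X \o _]eq_fun do rewrite /=.
  have E : (fun s => (\sum_(w <- [::]) W w s) * h j s) = cst 0.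
    by apply/funext => s; rewrite big_nil mul0r.
  rewrite E; split; first exact: integrable0.
  by rewrite Rintegral_cst// mul0r.
have E : (fun s => (\sum_(w <- w :: l) W w s) * h j s) =
    (fun s => W w s * h j s + (\sum_(w <- l) W w s) * h j s).
  by apply/funext => s; rewrite big_cons mulrDl.
rewrite E; have iw := integrable_word_integralM w j t tT.
split; first exact: integrable_add.
by rewrite RintegralD// big_cons IH.
Qed.

(** The shuffle relation is integration by parts, applied letter by letter. *)
Lemma word_integral_shuffle v w t : t \in `[0, T] ->
  W v t * W w t = \sum_(x <- shuffle v w) W x t.
Proof.
elim: v w t => [|a v IHv] w t tT; first by rewrite big_seq1/= mul1r.
elim: w t tT => [|b w IHw] t tT; first by rewrite big_seq1/= mulr1.
have /andP[t0 tT'] : 0 <= t <= T by rewrite in_itv/= in tT.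
rewrite [shuffle _ _]/= big_cat/= !sum_word_integral_cons//.
rewrite Rintegral_by_parts ?integrable_word_integralM// addrC.
congr (_ + _); apply: eq_Rintegral => s /[!inE] /=; rewrite in_itv/= => /andP[s0 st].
  transitivity (W (a :: v) s * W w s * h b s); first by rewrite /=; ring.
  by rewrite IHw// in_itv/= s0 (le_trans st).
transitivity (W v s * W (b :: w) s * h a s); first by rewrite /=; ring.
by rewrite IHv// in_itv/= s0 (le_trans st).
Qed.

(** The word of length [k] whose letters are the multi-index of a coordinate of
    the [k]-fold tensor power. The last tensor factor, which is the outermost
    integration, comes first in the word. *)
Fixpoint tensor_word (k : nat) : 'I_(M ^ k) -> seq 'I_M :=
  match k return 'I_(M ^ k) -> seq 'I_M with
  | 0 => fun _ => [::]
  | k'.+1 => fun i =>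
      let pq := mxtens_unindex (cast_ord (expnSr M k') i) in
      pq.2 :: tensor_word k' pq.1
  end.

Lemma tensor_word_surj (w : seq 'I_M) : exists i, tensor_word (size w) i = w.
Proof.
elim: w => [|j w [i IH]]; first by exists ord0.
exists (cast_ord (esym (expnSr M (size w))) (mxtens_index (i, j))).
have cons_word (k : 'I_(M ^ (size w).+1)) : tensor_word (size w).+1 k =
    let pq := mxtens_unindex (cast_ord (expnSr M (size w)) k) in
    pq.2 :: tensor_word (size w) pq.1 by [].
by rewrite cons_word cast_ordKV mxtens_indexK /= IH.
Qed.

(** For a path with integrable densities, the iterated Riemann-Stieltjes
    integrals are Lebesgue integrals. *)
Lemma iterated_integral_word (X : R -> 'cV[R]_M) :
  (forall s j, s \in `[0, T] -> X s j 0 = \int[mu]_(x in `[0, s]) h j x) ->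
  forall k t (i : 'I_(M ^ k)), t \in `[0, T] ->
    iterated_integral X 0 k t i 0 = W (tensor_word k i) t.
Proof.
move=> Xh; elim=> [|k IH] t i tT; first by rewrite mxE.
rewrite [LHS]mxE [RHS]/=.
set pq := mxtens_unindex _.
have /andP[t0 tT'] : 0 <= t <= T by rewrite in_itv/= in tT.
have subT s : s \in `[0, t] -> s \in `[0, T].
  by rewrite !in_itv/= => /andP[-> /le_trans]; exact.
rewrite (RS_integral_density _ _ (h pq.2))//.
- apply: eq_Rintegral => s; rewrite inE/= => /subT sT.
  by rewrite IH.
- apply: (@subspace_eq_continuous _ `[0, t] R (W (tensor_word k pq.1))).
    by move=> s; rewrite inE/= => /subT sT; rewrite /from_subspace IH.
  apply: continuous_segmentS (continuous_word_integral _) => //.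
- exact: integrable_segmentS (ih _).
- by move=> s /subT sT; exact: Xh.
Qed.

End word_integrals.

Section pairing.
Context {R : realType} {M : nat}.
Implicit Types (l S : @tensor_seq R M).

Lemma WspaceP l : Wspace l <-> exists N, forall k, (N <= k)%N -> l k = 0.
Proof.
split=> [/finite_seqP[D lD]|[N lN]].
  exists (\max_(k <- D) k).+1 => k kN.
  apply/eqP/negPn/negP => lk.
  have : k \in D by have : [set k | l k != 0] k by []; rewrite lD.
  by move=> kD; have := leq_bigmax_seq (F := id) k kD isT; rewrite leqNgt kN.
apply: (sub_finite_set _ (finite_II N)) => k /= lk.
by rewrite ltnNge; apply/negP => /lN lk0; rewrite lk0 eqxx in lk.
Qed.

Lemma pairing_finite N l S : (forall k, (N <= k)%N -> l k = 0) ->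
  pairing l S = \sum_(k < N) \sum_(i < M ^ k) l k i 0 * S k i 0.
Proof.
move=> lN; rewrite /pairing -(@fsbig_widen _ _ _ _ `I_N setT)//.
  by rewrite -(fsbig_ord _ N (fun k => \sum_(i < M ^ k) l k i 0 * S k i 0)).
move=> k /= [_ /negP]; rewrite -leqNgt => Nk.
by apply: big1 => i _; rewrite lN// mxE mul0r.
Qed.

Lemma WspaceD l l' : Wspace l -> Wspace l' -> Wspace (fun k => l k + l' k).
Proof.
move=> /WspaceP[N lN] /WspaceP[N' lN']; apply/WspaceP; exists (N + N')%N => k NNk.
by rewrite lN ?lN' ?addr0//; lia.
Qed.

Lemma WspaceZ a l : Wspace l -> Wspace (fun k => a *: l k).
Proof.
by move=> /WspaceP[N lN]; apply/WspaceP; exists N => k Nk; rewrite lN ?scaler0.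
Qed.

Lemma pairingD l l' S : Wspace l -> Wspace l' ->
  pairing (fun k => l k + l' k) S = pairing l S + pairing l' S.
Proof.
move=> /WspaceP[N lN] /WspaceP[N' lN']; rewrite !(@pairing_finite (N + N')).
- rewrite -big_split/=; apply: eq_bigr => k _; rewrite -big_split/=.
  by apply: eq_bigr => i _; rewrite mxE mulrDl.
- by move=> k ?; rewrite lN'//; lia.
- by move=> k ?; rewrite lN//; lia.
- by move=> k ?; rewrite lN ?lN' ?addr0//; lia.
Qed.

Lemma pairingZ a l S : Wspace l ->
  pairing (fun k => a *: l k) S = a * pairing l S.
Proof.
move=> /WspaceP[N lN]; rewrite !(@pairing_finite N)//.
- rewrite mulr_sumr; apply: eq_bigr => k _; rewrite mulr_sumr.
  by apply: eq_bigr => i _; rewrite mxE mulrA.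
- by move=> k ?; rewrite lN ?scaler0.
Qed.

(** The linear functional reading one coordinate. *)
Definition coordinate_functional k0 (i0 : 'I_(M ^ k0)) : @tensor_seq R M :=
  fun k => \col_i ((k == k0) && (i == i0 :> nat))%:R.

Lemma Wspace_coordinate k0 i0 : Wspace (@coordinate_functional k0 i0).
Proof.
apply/WspaceP; exists k0.+1 => k kk0; apply/colP => i.
by rewrite !mxE (_ : k == k0 = false)//; lia.
Qed.

Lemma pairing_coordinate k0 i0 S :
  pairing (@coordinate_functional k0 i0) S = S k0 i0 0.
Proof.
rewrite (@pairing_finite k0.+1); last first.
  move=> k kk0; apply/colP => i.
  by rewrite !mxE (_ : k == k0 = false)//; lia.
rewrite big_ord_recr/= big1 ?add0r => [|k _]; last first.
  apply: big1 => i _; rewrite mxE (_ : k == k0 :> nat = false) ?mul0r//.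
  by have := ltn_ord k; lia.
rewrite (bigD1 i0)//= mxE !eqxx mul1r big1 ?addr0// => i ii0.
by rewrite mxE eqxx/= -val_eqE in ii0 *; rewrite (negbTE ii0) mul0r.
Qed.

End pairing.

Section signature_functionals.
Context {R : realType} {U : Type}.
Local Notation mu := (@lebesgue_measure R).
Variables (T : R) (M : nat) (h : U -> 'I_M -> R -> R) (X : U -> R -> 'cV[R]_M).
Hypothesis T0 : 0 <= T.
Hypothesis ih : forall u j, mu.-integrable `[0, T] (EFin \o h u j).
Hypothesis Xh : forall u s j, s \in `[0, T] ->
  X u s j 0 = \int[mu]_(x in `[0, s]) h u j x.

(** The functions of (time, parameter) that agree on [0, T] with a linear
    functional of the signature of the paths [X u]. *)
Definition signature_functional : set (R * U -> R) :=
  [set g | exists2 l : tensor_seq M, Wspace l &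
    forall t u, t \in `[0, T] -> g (t, u) = pairing l (signature (X u) 0 t)].
Local Notation A := signature_functional.

Lemma signature_functionalD g g' : A g -> A g' -> A (g \+ g').
Proof.
move=> [l Wl gl] [l' Wl' gl']; exists (fun k => l k + l' k); first exact: WspaceD.
by move=> t u tT; rewrite /= gl// gl'// pairingD.
Qed.

Lemma signature_functionalZ (a : R) g : A g -> A (a \*o g).
Proof.
move=> [l Wl gl]; exists (fun k => a *: l k); first exact: WspaceZ.
by move=> t u tT; rewrite /= gl// pairingZ.
Qed.

Lemma eq_signature_functional g g' : A g ->
  (forall t u, t \in `[0, T] -> g' (t, u) = g (t, u)) -> A g'.
Proof. by move=> [l Wl gl] gg'; exists l => // t u tT; rewrite gg'// gl. Qed.

Lemma signature_functional_word w :
  A (fun p => word_integral M (h p.2) w p.1).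
Proof.
have [i iw] := tensor_word_surj M w.
exists (coordinate_functional (size w) i); first exact: Wspace_coordinate.
move=> t u tT; rewrite pairing_coordinate /signature.
by rewrite (iterated_integral_word T M (h u))// ?iw// => s j; exact: Xh.
Qed.

Lemma signature_functional1 : A (cst 1).
Proof. exact: (eq_signature_functional _ _ (signature_functional_word [::])). Qed.

Lemma signature_functional_sum I (r : seq I) (c : I -> R) (g : I -> R * U -> R) :
  (forall i, A (g i)) -> A (fun p => \sum_(i <- r) c i * g i p).
Proof.
move=> Ag; elim: r => [|i r IH].
  apply: (eq_signature_functional (0 \*o cst 1)).
    exact: signature_functionalZ signature_functional1.
  by move=> t u _; rewrite big_nil/= mul0r.
apply: (eq_signature_functional ((c i \*o g i) \+
    (fun p => \sum_(i <- r) c i * g i p))).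
  exact: signature_functionalD (signature_functionalZ _ _ (Ag i)) IH.
by move=> t u _; rewrite big_cons.
Qed.

Lemma signature_functional_expand g : A g ->
  exists r : seq (R * seq 'I_M), forall t u, t \in `[0, T] ->
    g (t, u) = \sum_(cw <- r) cw.1 * word_integral M (h u) cw.2 t.
Proof.
move=> [l /WspaceP[N lN] gl].
exists (flatten [seq [seq (l k i 0, tensor_word M k i) | i <- index_enum 'I_(M ^ k)] |
    k <- iota 0 N]).
move=> t u tT; rewrite gl// (pairing_finite N)// big_flatten/= big_map.
rewrite -(big_mkord xpredT (fun k => \sum_(i < M ^ k) l k i 0 *
   signature (X u) 0 t k i 0)).
rewrite /index_iota subn0; apply: eq_bigr => k _; rewrite big_map.
apply: eq_bigr => i _; congr (_ * _).
by rewrite /signature (iterated_integral_word T M (h u))// => s j; exact: Xh.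
Qed.

(** The functionals form an algebra because the shuffles of two words express
    the product of the corresponding iterated integrals. *)
Lemma signature_functionalM g g' : A g -> A g' -> A (g \* g').
Proof.
move=> /signature_functional_expand[r gr] /signature_functional_expand[r' gr'].
apply: (eq_signature_functional (fun p => \sum_(cw <- r) cw.1 *
  \sum_(cw' <- r') cw'.1 * \sum_(x <- shuffle cw.2 cw'.2)
    1 * word_integral M (h p.2) x p.1)).
  apply: signature_functional_sum => cw; apply: signature_functional_sum => cw'.
  by apply: signature_functional_sum => x; exact: signature_functional_word.
move=> t u tT /=; rewrite gr// gr'// mulr_suml; apply: eq_bigr => cw _.
rewrite -mulrA; congr (_ * _); rewrite mulr_sumr; apply: eq_bigr => cw' _.
rewrite mulrCA; congr (_ * _); rewrite (word_integral_shuffle T)//.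
by apply: eq_bigr => x _; rewrite mul1r.
Qed.

End signature_functionals.

(** * Gronwall's inequality with a square-integrable weight *)

Section gronwall.
Context {R : realType}.
Local Notation mu := (@lebesgue_measure R).
Implicit Types (F f h phi beta : R -> R) (a b t : R).

Lemma Rintegral_derive F f a b : a <= b -> continuous f ->
  (forall x : R, is_derive x (1 : R) F (f x)) ->
  \int[mu]_(x in `[a, b]) f x = F b - F a.
Proof.
rewrite le_eqVlt => /predU1P[->|ab] cf dF.
  by rewrite set_itv1 Rintegral_set1 subrr.
have cF x : {for x, continuous F}.
  by apply: differentiable_continuous; apply/derivable1_diffP; exact: ex_derive.
rewrite /Rintegral (@continuous_FTC2 _ _ F)//.
- exact: continuous_subspaceT.
- split; first by move=> x _; exact: ex_derive.
  + by apply: cvg_at_right_filter; exact: cF.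
  + by apply: cvg_at_left_filter; exact: cF.
- by move=> x _; rewrite derive1E derive_val.
Qed.

Lemma Rintegral_exprn n t : 0 <= t ->
  \int[mu]_(x in `[0, t]) x ^+ n = t ^+ n.+1 / n.+1%:R.
Proof.
move=> t0; pose p : {poly R} := n.+1%:R^-1 *: 'X^(n.+1).
have dp (x : R) : is_derive x (1 : R) (horner p) (x ^+ n).
  have := is_derive_poly p x.
  rewrite derivZ derivXn hornerZ hornerMn hornerXn -(mulr_natr (x ^+ _)) mulrCA.
  by rewrite mulVf ?mulr1// pnatr_eq0.
rewrite (Rintegral_derive _ _ _ _ t0 _ dp); last exact: exprn_continuous.
by rewrite !hornerZ !hornerXn expr0n/= mulr0 subr0 mulrC.
Qed.

Lemma Rintegral_expR_le (k c : R) : 0 < k -> 0 <= c ->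
  \int[mu]_(s in `[0, c]) expR (k * (s - c)) <= k^-1.
Proof.
move=> k0 c0; pose q : {poly R} := k *: ('X - c%:P).
have qE s : q.[s] = k * (s - c) by rewrite hornerZ hornerXsubC.
have cq : continuous (fun s => expR (k * (s - c))).
  rewrite (_ : (fun _ => _) = expR \o horner q); last first.
    by apply/funext => s /=; rewrite qE.
  by move=> x; apply: continuous_comp; [exact: continuous_horner|exact: continuous_expR].
have iq : mu.-integrable `[0, c] (EFin \o (fun s => expR (k * (s - c)))).
  by apply: continuous_integrable_segment; exact: continuous_subspaceT.
rewrite -(@ler_pM2l _ k)// divff ?gt_eqF// -RintegralZl//.
have dq (x : R) : is_derive x (1 : R) (expR \o horner q) (k * expR (k * (x - c))).
  have := is_derive1_comp (is_derive_expR q.[x]) (is_derive_poly q x).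
  by rewrite derivZ derivXsubC hornerZ hornerC mulr1 qE mulrC.
rewrite (Rintegral_derive _ _ _ _ c0 _ dq)/=.
  rewrite !qE subrr mulr0 expR0 lerBlDr lerDl; exact: expR_ge0.
by move=> x; apply: cvgM; [exact: cvg_cst|exact: cq].
Qed.

(** The maximum [M] of [exp (- 2 B t) phi t] satisfies [M <= a + M / 2], because
    the Young inequality bounds the integral of [beta s * exp (- 2 B (c - s))]
    over [0, c] by one half. *)
Lemma gronwall_L2 (T a B : R) phi beta : 0 <= T -> 0 < B ->
  {within `[0, T], continuous phi} ->
  (forall t, t \in `[0, T] -> 0 <= phi t) ->
  (forall t, t \in `[0, T] -> 0 <= beta t) ->
  mu.-integrable `[0, T] (EFin \o beta) ->
  mu.-integrable `[0, T] (EFin \o (fun s => beta s ^+ 2)) ->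
  \int[mu]_(s in `[0, T]) beta s ^+ 2 <= B ->
  (forall t, t \in `[0, T] -> phi t <= a + \int[mu]_(s in `[0, t]) (phi s * beta s)) ->
  forall t, t \in `[0, T] -> phi t <= 2 * a * expR (2 * B * T).
Proof.
move=> T0 B0 cphi phi0 beta0 ib ib2 bB ineq.
have T00 : 0 \in `[0, T] by rewrite in_itv/= lexx.
have a0 : 0 <= a.
  apply: le_trans (phi0 _ T00) _; apply: le_trans (ineq _ T00) _.
  by rewrite set_itv1 Rintegral_set1 addr0.
pose C := 2 * B; have C0 : 0 < C by rewrite mulr_gt0.
pose E s := expR (- (C * s)).
have E0 s : 0 < E s by exact: expR_gt0.
have cE : continuous E.
  move=> x; apply: continuous_comp; last exact: continuous_expR.
  by apply: cvgN; apply: cvgM => //; exact: cvg_cst.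
pose g s := E s * phi s.
have cg : {within `[0, T], continuous g}.
  have cET : {within `[0, T], continuous E} by exact: continuous_subspaceT.
  by move=> x; apply: cvgM; [exact: cET|exact: cphi].
have [c cT gc] := EVT_max T0 cg.
have /andP[c0 cT'] : 0 <= c <= T by rewrite in_itv/= in cT.
pose M := g c; have M0 : 0 <= M by rewrite /M mulr_ge0 ?phi0// ltW.
have phig s : phi s = expR (C * s) * g s.
  by rewrite /g /E expRN mulrA divff ?mul1r// gt_eqF// expR_gt0.
have subT s : s \in `[0, c] -> s \in `[0, T].
  by rewrite !in_itv/= => /andP[-> /le_trans]; exact.
pose K s := expR (C * (s - c)).
have cK : continuous K.
  move=> x; apply: continuous_comp; last exact: continuous_expR.
  apply: cvgM; first exact: cvg_cst.
  by apply: cvgB => //; exact: cvg_cst.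
have cK2 : continuous (fun s => expR (2 * C * (s - c))).
  move=> x; apply: continuous_comp; last exact: continuous_expR.
  apply: cvgM; first exact: cvg_cst.
  by apply: cvgB => //; exact: cvg_cst.
have ibc := integrable_segmentS _ _ _ _ _ (lexx 0) cT' ib.
have ib2c := integrable_segmentS _ _ _ _ _ (lexx 0) cT' ib2.
have cphic := continuous_segmentS _ _ _ _ _ (lexx 0) cT' cphi.
have iK : mu.-integrable `[0, c] (EFin \o (fun s => K s * beta s)).
  by apply: continuous_integrableM => //; exact: continuous_subspaceT.
have iphib := continuous_integrableM _ _ _ _ cphic ibc.
have iK2 : mu.-integrable `[0, c] (EFin \o (fun s => expR (2 * C * (s - c)))).
  by apply: continuous_integrable_segment; exact: continuous_subspaceT.
have half : \int[mu]_(s in `[0, c]) (K s * beta s) <= 2^-1.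
  have young s : K s * beta s <=
      (4 * B)^-1 * beta s ^+ 2 + B * expR (2 * C * (s - c)).
    have -> : expR (2 * C * (s - c)) = K s ^+ 2.
      by rewrite /K expr2 -expRD; congr expR; ring.
    rewrite -subr_ge0 [leRHS](_ : _ = (4 * B)^-1 * (beta s - 2 * B * K s) ^+ 2).
      by rewrite mulr_ge0 ?sqr_ge0// invr_ge0 mulr_ge0// ltW.
    by field; rewrite gt_eqF.
  have iy1 : mu.-integrable `[0, c] (EFin \o (fun s => (4 * B)^-1 * beta s ^+ 2)).
    exact: integrable_scale.
  have iy2 : mu.-integrable `[0, c]
      (EFin \o (fun s => B * expR (2 * C * (s - c)))).
    exact: integrable_scale.
  apply: (@le_trans _ _ (\int[mu]_(s in `[0, c])
     ((4 * B)^-1 * beta s ^+ 2 + B * expR (2 * C * (s - c))))).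
    by apply: le_Rintegral => //; exact: integrable_add.
  rewrite RintegralD// !RintegralZl//.
  have b1 : \int[mu]_(s in `[0, c]) beta s ^+ 2 <= B.
    apply: le_trans bB; rewrite -subr_ge0 (Rintegral_segmentB _ 0 T)//.
    by apply: Rintegral_ge0 => x _; exact: sqr_ge0.
  have b2 : \int[mu]_(s in `[0, c]) expR (2 * C * (s - c)) <= (2 * C)^-1.
    by apply: Rintegral_expR_le => //; rewrite mulr_gt0.
  have b3 : (4 * B)^-1 * \int[mu]_(s in `[0, c]) beta s ^+ 2 <= (4 * B)^-1 * B.
    by rewrite ler_wpM2l// invr_ge0 mulr_ge0// ltW.
  have b4 : B * \int[mu]_(s in `[0, c]) expR (2 * C * (s - c)) <= B * (2 * C)^-1.
    by rewrite ler_wpM2l// ltW.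
  apply: le_trans (lerD b3 b4) _; rewrite /C le_eqVlt; apply/orP; left; apply/eqP.
  by field; rewrite gt_eqF.
have M2 : M <= a + M / 2.
  have e1 : M <= E c * (a + \int[mu]_(s in `[0, c]) (phi s * beta s)).
    by rewrite /M /g ler_wpM2l ?ineq// ltW.
  apply: le_trans e1 _; rewrite mulrDr lerD//.
    rewrite ler_piMl// /E -expR0 ler_expR oppr_le0 mulr_ge0// ltW//.
  rewrite -RintegralZl//; apply: (@le_trans _ _ (\int[mu]_(s in `[0, c]) (M * (K s * beta s)))).
    apply: le_Rintegral => //; try exact: integrable_scale.
    move=> s /= sc; have sT := subT _ sc.
    rewrite phig (_ : K s = E c * expR (C * s)); last first.
      by rewrite /K /E -expRD; congr expR; ring.
    rewrite [leLHS](_ : _ = (E c * expR (C * s) * beta s) * g s); last by ring.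
    rewrite [leRHS]mulrC ler_wpM2l ?gc// mulr_ge0 ?beta0//.
    by rewrite mulr_ge0 ?expR_ge0// ltW.
  by rewrite RintegralZl// ler_wpM2l.
have Ma : M <= 2 * a by lra.
move=> t tT; rewrite phig mulrC; apply: ler_pM.
- by rewrite mulr_ge0 ?phi0// ltW.
- exact: expR_ge0.
- exact: le_trans (gc _ tT) Ma.
- by move: tT; rewrite in_itv/= => /andP[_ tT]; rewrite ler_expR ler_pM2l.
Qed.

End gronwall.

(** * A function with vanishing moments has a vanishing primitive *)

Section moments.
Context {R : realType}.
Local Notation mu := (@lebesgue_measure R).
Implicit Types (F f h phi : R -> R) (p : {poly R}) (a b t r : R).

Lemma weierstrass F a b : {within `[a, b], continuous F} ->
  forall e, 0 < e -> exists p : {poly R}, forall x, x \in `[a, b] ->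
    `|F x - p.[x]| < e.
Proof.
move=> cF e e0.
pose A : set (R -> R) := [set g | exists p : {poly R}, g = fun x => p.[x]].
have [|||||||_ [p ->] pF] := stone_weierstrass `[a, b] A _ _ _ _ _ _ F cF _ e e0.
- exact: segment_compact.
- by exists 1; apply/funext => x; rewrite hornerC.
- by move=> _ _ [p ->] [q ->]; exists (p + q); apply/funext => x; rewrite hornerD.
- by move=> k _ [p ->]; exists (k *: p); apply/funext => x; rewrite hornerZ.
- by move=> _ _ [p ->] [q ->]; exists (p * q); apply/funext => x; rewrite hornerM.
- by move=> _ [p ->]; apply: continuous_subspaceT; exact: continuous_horner.
- move=> x y _ _ /(_ (fun x => 'X.[x])) Axy; congr F.
  by move: Axy; rewrite /= !hornerX; apply; exists 'X.
- by exists p.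
Qed.

Lemma continuous_Rintegral_eq0 F a b : a < b -> {within `[a, b], continuous F} ->
  (forall x, x \in `[a, b] -> 0 <= F x) ->
  \int[mu]_(x in `[a, b]) F x <= 0 -> forall x, x \in `[a, b] -> F x = 0.
Proof.
have sum_parts (I1 I2 I3 I4 I5 z : R) : I2 - I1 = I3 -> I4 - I2 = I5 ->
  0 <= I1 -> 0 <= I5 -> I4 <= 0 -> z <= I3 -> 0 < z -> False by lra.
move=> ab cF F0 iF0 x xab; apply/eqP; rewrite eq_le F0// andbT leNgt.
apply/negP => Fx; have e0 : 0 < F x / 2 by rewrite divr_gt0.
have [d d0 dF] := uniformly_continuous_segment _ _ _ cF _ e0.
have /andP[ax xb] : a <= x <= b by rewrite in_itv/= in xab.
pose u := Num.max a (x - d / 2); pose v := Num.min b (x + d / 2).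
have uv : u < v.
  by rewrite /u /v gt_max !lt_min; apply/andP; split; apply/andP; split; lra.
have au : a <= u by rewrite le_max lexx.
have vb : v <= b by rewrite ge_min lexx.
have xu : x - d / 2 <= u by rewrite le_max lexx orbT.
have vx : v <= x + d / 2 by rewrite ge_min lexx orbT.
clearbody u v; have near_x y : u <= y -> y <= v -> F x / 2 <= F y.
  move=> uy yv.
  have yab : y \in `[a, b] by rewrite in_itv/=; apply/andP; split; lra.
  have : `|x - y| < d by rewrite ltr_norml; apply/andP; split; lra.
  by move=> /(dF _ _ xab yab); rewrite ltr_norml; lra.
have iF := continuous_integrable_segment _ _ _ cF.
have ge0 (r s : R) : a <= r -> r <= s -> s <= b -> 0 <= \int[mu]_(x in `[r, s]) F x.
  move=> ar rs sb; apply: Rintegral_ge0 => y /=; rewrite in_itv/= => /andP[? ?].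
  by apply: F0; rewrite in_itv/=; apply/andP; split; lra.
have ub : u <= b := le_trans (ltW uv) vb.
have i1 := Rintegral_segmentB F a b u v au (ltW uv) vb iF.
have i2 := Rintegral_segmentB F a b v b (le_trans au (ltW uv)) vb (lexx b) iF.
have g1 := ge0 a u (lexx a) au ub.
have g2 := ge0 v b (le_trans au (ltW uv)) vb (lexx b).
have low : F x / 2 * (v - u) <= \int[mu]_(x in `[u, v]) F x.
  rewrite (_ : _ * _ = \int[mu]_(y in `[u, v]) (F x / 2)); last first.
    rewrite Rintegral_cst//= lebesgue_measure_itv/= lte_fin uv.
    by [].
  apply: le_Rintegral => //.
  - by apply: continuous_integrable_segment; apply: continuous_subspaceT => ?; exact: cvg_cst.
  - exact: integrable_segmentS iF.
  - move=> y /=; rewrite in_itv/= => /andP[uy yv]. exact: near_x.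
apply: (sum_parts _ _ _ _ _ _ i1 i2 g1 g2 iF0 low).
by rewrite mulr_gt0// subr_gt0.
Qed.

Lemma Rintegral_horner_eq0 h t : mu.-integrable `[0, t] (EFin \o h) ->
  (forall n, \int[mu]_(s in `[0, t]) (s ^+ n * h s) = 0) ->
  forall p, \int[mu]_(s in `[0, t]) (p.[s] * h s) = 0.
Proof.
move=> ih mom p.
have in_ n : mu.-integrable `[0, t] (EFin \o (fun s => s ^+ n * h s)).
  apply: continuous_integrableM => //; apply: continuous_subspaceT.
  exact: exprn_continuous.
pose Q n := \sum_(i < n) p`_i *: 'X^i.
suff Q0 n : mu.-integrable `[0, t] (EFin \o (fun s => (Q n).[s] * h s)) /\
    \int[mu]_(s in `[0, t]) ((Q n).[s] * h s) = 0.
  have [_ ] := Q0 (size p); rewrite (_ : Q (size p) = p)//.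
  by rewrite /Q -poly_def coefK.
elim: n => [|n [iQ Q0]].
  rewrite /Q big_ord0 (_ : (fun s => _) = cst 0).
    by split; [exact: integrable0|rewrite Rintegral_cst// mul0r].
  by apply/funext => s; rewrite horner0 mul0r.
have -> : (fun s => (Q n.+1).[s] * h s) =
    (fun s => (Q n).[s] * h s + p`_n * (s ^+ n * h s)).
  by apply/funext => s; rewrite /Q big_ord_recr/= hornerD hornerZ hornerXn mulrDl mulrA.
have i2 : mu.-integrable `[0, t] (EFin \o (fun s => p`_n * (s ^+ n * h s))).
  exact: integrable_scale.
split; first exact: integrable_add.
by rewrite RintegralD// Q0 RintegralZl// mom mulr0 addr0.
Qed.

(** Integration by parts turns the vanishing moments of [h] into those of its
    primitive, which is continuous and hence approximable by polynomials. *)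
Lemma moments_primitive_eq0 h t : 0 <= t -> mu.-integrable `[0, t] (EFin \o h) ->
  (forall n, \int[mu]_(s in `[0, t]) (s ^+ n * h s) = 0) ->
  forall r, r \in `[0, t] -> \int[mu]_(s in `[0, r]) h s = 0.
Proof.
rewrite le_eqVlt => /predU1P[<- _ _ r|t0 ih mom].
  rewrite in_itv/= -eq_le => /eqP <-; by rewrite set_itv1 Rintegral_set1.
pose H r := \int[mu]_(s in `[0, r]) h s.
have cH : {within `[0, t], continuous H}.
  by apply: continuous_indefinite_integral => //; exact: ltW.
have Ht : H t = 0.
  by rewrite -(mom 0%N); apply: eq_Rintegral => s _; rewrite expr0 mul1r.
have iH := continuous_integrable_segment _ _ _ cH.
have cX n : {within `[0, t], continuous (fun x : R => x ^+ n)}.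
  by apply: continuous_subspaceT; exact: exprn_continuous.
have iX n := continuous_integrable_segment _ _ _ (cX n).
have iXH n := continuous_integrableM _ _ _ _ (cX n) iH.
have momH n : \int[mu]_(s in `[0, t]) (s ^+ n * H s) = 0.
  have := Rintegral_by_parts _ _ _ _ (ltW t0) (iX n) ih.
  rewrite -/(H t) Ht mulr0 [X in _ = X + _](_ : _ = 0) ?add0r; last first.
    transitivity (\int[mu]_(s in `[0, t]) (n.+1%:R^-1 * (s ^+ n.+1 * h s))).
      apply: eq_Rintegral => s; rewrite inE/= in_itv/= => /andP[s0 _].
      by rewrite Rintegral_exprn//; ring.
    rewrite RintegralZl ?mom ?mulr0//.
    exact: continuous_integrableM.
  by move=> E; rewrite [RHS]E; apply: eq_Rintegral => s _; rewrite mulrC.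
have polyH := Rintegral_horner_eq0 _ _ iH momH.
have iHH := continuous_integrableM _ _ _ _ cH iH.
have HH0 : \int[mu]_(s in `[0, t]) (H s * H s) <= 0.
  apply/ler_addgt0Pl => e e0; rewrite addr0.
  pose I := \int[mu]_(s in `[0, t]) `|H s|.
  have I0 : 0 <= I by exact: Rintegral_ge0.
  have I1 : 0 < I + 1 by rewrite ltr_wpDl.
  have [p pH] := weierstrass _ _ _ cH _ (divr_gt0 e0 I1).
  have cp : {within `[0, t], continuous (fun x => p.[x])}.
    by apply: continuous_subspaceT; exact: continuous_horner.
  have ip := continuous_integrableM _ _ _ _ cp iH.
  rewrite -[leLHS]subr0 -[X in _ - X](polyH p) -RintegralB//.
  apply: (@le_trans _ _ (\int[mu]_(s in `[0, t]) (e / (I + 1) * `|H s|))).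
    apply: le_Rintegral => //; first exact: integrable_sub.
      by apply: integrable_scale => //; exact: integrable_norm.
    move=> s /= sT; rewrite -mulrBl (le_trans (ler_norm _))// normrM ler_wpM2r//.
    by rewrite ltW// pH.
  rewrite RintegralZl//; last exact: integrable_norm.
  rewrite -/I mulrAC ler_pdivrMr// ler_pM2l//; lra.
move=> r rt; apply/eqP; rewrite -[_ == 0]orbb -mulf_eq0; apply/eqP.
apply: (continuous_Rintegral_eq0 (fun s => H s * H s) 0 t) => //.
- by move=> x; apply: cvgM; exact: cH.
- by move=> x _; rewrite -expr2 sqr_ge0.
Qed.

(** With the integral seen as a Riemann-Stieltjes integral against the
    primitive of [h], no almost-everywhere argument is needed. *)
Lemma primitive_eq0_Rintegral h phi t : 0 <= t ->
  mu.-integrable `[0, t] (EFin \o h) ->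
  (forall r, r \in `[0, t] -> \int[mu]_(s in `[0, r]) h s = 0) ->
  {within `[0, t], continuous phi} ->
  \int[mu]_(s in `[0, t]) (phi s * h s) = 0.
Proof.
move=> t0 ih h0 cphi.
rewrite -(RS_integral_density phi (cst 0) h 0 t)//; last by move=> s /h0 ->.
rewrite (RS_integral_density phi (cst 0) (cst 0))//.
- rewrite (_ : (fun x => _) = cst 0); first by rewrite Rintegral_cst// mul0r.
  by apply/funext => s /=; rewrite mulr0.
- exact: integrable0.
- by move=> s _; rewrite Rintegral_cst// mul0r.
Qed.

End moments.

(** * Euclidean and operator norms of entries *)

Section entries.
Context {R : realType}.

Lemma entry_le_enorm n (v : 'cV[R]_n) i : `|v i 0| <= enorm v.
Proof.
rewrite -(@ler_pXn2r _ 2)// ?nnegrE ?enorm_ge0// sqr_enorm real_normK ?num_real//.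
by rewrite (bigD1 i)//= lerDl sumr_ge0// => j _; exact: sqr_ge0.
Qed.

Lemma enorm_le_sum n (v : 'cV[R]_n) : enorm v <= \sum_i `|v i 0|.
Proof.
have s0 : 0 <= \sum_i `|v i 0| by exact: sumr_ge0.
rewrite -(@ler_pXn2r _ 2)// ?nnegrE ?enorm_ge0// sqr_enorm [leRHS]expr2 mulr_suml.
apply: ler_sum => i _; rewrite -real_normK ?num_real// expr2 ler_wpM2l//.
by rewrite (bigD1 i)//= lerDl sumr_ge0.
Qed.

Lemma enormB n (v w : 'cV[R]_n) : enorm (v - w) = enorm (w - v).
Proof. by rewrite -enormN opprB. Qed.

Lemma enorm_dist n (v w : 'cV[R]_n) : `|enorm v - enorm w| <= enorm (v - w).
Proof.
have h (a b : 'cV[R]_n) : enorm a - enorm b <= enorm (a - b).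
  by rewrite lerBlDr (le_trans _ (enormD _ _))// subrK.
by rewrite ler_norml h andbT lerNl opprB enormB h.
Qed.

Lemma entry_le_opnorm m n (A : 'M[R]_(m, n)) i j : `|A i j| <= opnorm A.
Proof.
pose v : 'cV[R]_n := delta_mx j 0.
have Av : (A *m v) i 0 = A i j.
  rewrite mxE (bigD1 j)//= mxE !eqxx mulr1 big1 ?addr0// => k kj.
  by rewrite mxE (negbTE kj) mulr0.
apply: (@le_trans _ _ (enorm (A *m v))); first by rewrite -Av entry_le_enorm.
apply: ub_le_sup; last first.
  exists v => //=; rewrite /enorm (bigD1 j)//= big1 ?addr0 => [|k kj].
    by rewrite mxE !eqxx expr1n sqrtr1.
  by rewrite mxE (negbTE kj) expr0n.
exists (\sum_i \sum_j `|A i j|) => _ [w /= w1 <-].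
apply: le_trans (enorm_le_sum _ _) _; apply: ler_sum => k _.
rewrite mxE; apply: le_trans (ler_norm_sum _ _ _) _; apply: ler_sum => l _.
by rewrite normrM ler_piMr// (le_trans (entry_le_enorm _ w l)).
Qed.

End entries.

(** * Square-integrable controls *)

Section L2_controls.
Context {R : realType}.
Local Notation mu := (@lebesgue_measure R).
Variables (T : R) (T0 : 0 <= T).
Local Notation D := (`[0, T]%classic).

Lemma integrable_segment_cst (a b k : R) :
  mu.-integrable `[a, b] (EFin \o (fun=> k)).
Proof.
by apply: continuous_integrable_segment; apply: continuous_subspaceT => ?; exact: cvg_cst.
Qed.

Lemma Rintegral_segment_cst (k : R) : \int[mu]_(x in D) k = k * T.
Proof.
rewrite Rintegral_cst//= lebesgue_measure_itv/= lte_fin.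
case: ifPn => [_|]; first by rewrite -EFinB subr0.
by rewrite -leNgt => TT; rewrite (@le_anti _ _ T 0) ?T0 ?TT.
Qed.

Lemma measurable_enorm n (g : R -> 'cV[R]_n) :
  (forall i, measurable_fun D (fun t => g t i 0)) ->
  measurable_fun D (fun t => enorm (g t)).
Proof.
move=> mg; rewrite /enorm.
have ms : measurable_fun setT (Num.sqrt : R -> R).
  by apply: continuous_measurable_fun; exact: sqrt_continuous.
apply: (measurableT_comp ms); apply: measurable_sum => i.
by apply: measurable_funX; exact: mg.
Qed.

Lemma L2norm_lt n (g : R -> 'cV[R]_n) (e : R) : 0 < e ->
  (forall i, measurable_fun D (fun t => g t i 0)) -> (L2norm T g < e%:E)%E ->
  mu.-integrable D (EFin \o (fun t => enorm (g t) ^+ 2)) /\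
  \int[mu]_(t in D) enorm (g t) ^+ 2 <= e ^+ 2.
Proof.
move=> e0 mg ge.
have le : (\int[mu]_(t in D) (enorm (g t) ^+ 2)%:E <= (e ^+ 2)%:E)%E.
  have : (L2norm T g `^ 2 <= e%:E `^ 2)%E.
    apply: gt0_ler_poweR => //; last exact: ltW.
      by rewrite in_itv/= leey andbT; exact: Lnorm_ge0.
    by rewrite in_itv/= leey andbT lee_fin ltW.
  have two0 : (2 : R) != 0 by [].
  rewrite [leRHS]poweR_EFin (powR_mulrn _ (ltW e0)) {1}/L2norm.
  rewrite (powR_Lnorm _ _ two0).
  apply: le_trans; rewrite [leLHS]integral_mkcond le_eqVlt; apply/orP; left.
  apply/eqP/eq_integral => t _ /=; rewrite !patchE.
  case: ifPn => _; last by rewrite /= normr0 powR0.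
  by rewrite /= ger0_norm ?enorm_ge0// powR_mulrn ?enorm_ge0.
have int : mu.-integrable D (EFin \o (fun t => enorm (g t) ^+ 2)).
  apply/integrableP; split.
    by apply/measurable_EFinP; apply: measurable_funX; exact: measurable_enorm.
  under eq_integral do rewrite /= ger0_norm ?sqr_ge0//.
  exact: le_lt_trans le (ltry _).
split=> //; rewrite -lee_fin /Rintegral fineK//.
exact: integrable_fin_num.
Qed.

Lemma integrable_of_sqr n (g : R -> 'cV[R]_n) :
  (forall i, measurable_fun D (fun t => g t i 0)) ->
  mu.-integrable D (EFin \o (fun t => enorm (g t) ^+ 2)) ->
  mu.-integrable D (EFin \o (fun t => enorm (g t))).
Proof.
move=> mg ig.
have i1 : mu.-integrable D (EFin \o (fun t => 1 + enorm (g t) ^+ 2)).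
  by apply: integrable_add => //; exact: integrable_segment_cst.
apply: le_integrable i1 => //.
  by apply/measurable_EFinP; exact: measurable_enorm.
move=> t _ /=; rewrite lee_fin ger0_norm ?enorm_ge0// ger0_norm ?addr_ge0 ?sqr_ge0//.
have := sqr_ge0 (enorm (g t) - 1); have := enorm_ge0 (g t).
by rewrite sqrrB1; lra.
Qed.

Lemma integrable_entry n (g : R -> 'cV[R]_n) i :
  (forall i, measurable_fun D (fun t => g t i 0)) ->
  mu.-integrable D (EFin \o (fun t => enorm (g t))) ->
  mu.-integrable D (EFin \o (fun t => g t i 0)).
Proof.
move=> mg ig; apply: le_integrable ig => //.
  by apply/measurable_EFinP; exact: mg.
by move=> t _ /=; rewrite lee_fin (ger0_norm (enorm_ge0 _)) entry_le_enorm.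
Qed.

Lemma L2norm_lt_integral n (g : R -> 'cV[R]_n) (e : R) : 0 < e ->
  (forall i, measurable_fun D (fun t => g t i 0)) -> (L2norm T g < e%:E)%E ->
  \int[mu]_(t in D) enorm (g t) <= e * (1 + T).
Proof.
move=> e0 mg ge; have [ig2 le_g2] := L2norm_lt _ _ _ e0 mg ge.
have ig := integrable_of_sqr _ _ mg ig2.
(* Integrate the pointwise bound x <= x^2 / e + e. *)
have i1 : mu.-integrable D (EFin \o (fun t => e^-1 * enorm (g t) ^+ 2)).
  exact: integrable_scale.
have i2 := integrable_segment_cst 0 T e.
apply: (@le_trans _ _ (\int[mu]_(t in D) (e^-1 * enorm (g t) ^+ 2 + e))).
  apply: le_Rintegral => //; first exact: integrable_add.
  move=> t _; have x0 := enorm_ge0 (g t).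
  rewrite -(@ler_pM2l _ e)// mulrDr mulrA divff ?gt_eqF// mul1r.
  by have := sqr_ge0 (enorm (g t) - e); nra.
rewrite RintegralD// RintegralZl// Rintegral_segment_cst mulrDr mulr1 lerD2r.
by rewrite ler_pdivrMl// -expr2.
Qed.

Section control.
Variables (m : nat).
Implicit Types u v : L2 T m.

Lemma L2_sub_measurable u v i : measurable_fun D (fun t => (u t - v t) i 0).
Proof.
rewrite (_ : (fun _ => _) = (fun t => u t i 0 - v t i 0)); last first.
  by apply/funext => t; rewrite !mxE.
by apply: measurable_funB; exact: L2_measurable.
Qed.

Lemma L2_sqr_integrable u :
  mu.-integrable D (EFin \o (fun t => enorm (u t) ^+ 2)).
Proof.
have [r r0 ur] : exists2 r : R, 0 < r & (L2norm T u < r%:E)%E.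
  have := L2_finite u; have : (0 <= L2norm T u)%E by exact: Lnorm_ge0.
  case: (L2norm T u) => [r||]//; rewrite lee_fin => r0 _.
  by exists (r + 1); rewrite ?lte_fin ?ltrDl// ltr_wpDl.
by have [] := L2norm_lt _ _ _ r0 (@L2_measurable _ _ _ u) ur.
Qed.

Lemma L2_enorm_integrable u : mu.-integrable D (EFin \o (fun t => enorm (u t))).
Proof.
by apply: integrable_of_sqr; [exact: L2_measurable|exact: L2_sqr_integrable].
Qed.

Lemma L2_integrable u i : mu.-integrable D (EFin \o (fun t => u t i 0)).
Proof.
by apply: integrable_entry; [exact: L2_measurable|exact: L2_enorm_integrable].
Qed.

Lemma near_L2 u (e : R) : 0 < e ->
  nbhs u [set v : L2 T m | (L2norm T (fun t => u t - v t)%R < e%:E)%E].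
Proof. by move=> e0; apply/nbhs_ballP; exists e. Qed.

End control.
End L2_controls.

(** * Dependence on the control *)

Section joint_continuity.
Context {R : realType}.
Local Notation mu := (@lebesgue_measure R).

(** Continuity in time, together with continuity in the parameter that is
    uniform in time, gives joint continuity. *)
Lemma joint_continuity (U : topologicalType) (T : R) (K : set U) (g : R -> U -> R) :
  (forall u, {within `[0, T], continuous g ^~ u}) ->
  (forall u (e : R), 0 < e -> exists2 N, nbhs u N &
     forall v t, N v -> t \in `[0, T] -> `|g t u - g t v| < e) ->
  {within `[0, T] `*` K, continuous (fun p : R * U => g p.1 p.2)}.
Proof.
move=> gt gu; apply/subspace_continuousP => -[t u] [/= tT Ku].
apply/cvgrPdist_lt => e e0; have e2 : 0 < e / 2 by rewrite divr_gt0.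
have [N Nu gN] := gu u _ e2.
have /subspace_continuousP /(_ t tT) /cvgrPdist_lt /(_ _ e2) := gt u.
rewrite !near_withinE => gtu.
exists ([set s | s \in `[0, T] -> `|g t u - g s u| < e / 2], N) => //=.
move=> [s v] [/= gs Nv] [/= sT Kv].
rewrite (_ : g t u - g s v = (g t u - g s u) + (g s u - g s v)); last by ring.
by rewrite (le_lt_trans (ler_normD _ _))// [ltRHS]splitr ltrD// ?gs// gN.
Qed.

(** Word integrals depend continuously on the densities for the L^1 distance,
    uniformly in time. *)
Lemma word_integral_stable (T : R) M (h : 'I_M -> R -> R) w (e : R) : 0 <= T ->
  (forall j, mu.-integrable `[0, T] (EFin \o h j)) -> 0 < e ->
  exists2 eta, 0 < eta & forall h' : 'I_M -> R -> R,
    (forall j, mu.-integrable `[0, T] (EFin \o h' j)) ->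
    (forall j, \int[mu]_(s in `[0, T]) `|h j s - h' j s| <= eta) ->
    forall t, t \in `[0, T] ->
      `|word_integral M h w t - word_integral M h' w t| <= e.
Proof.
move=> T0 ih; elim: w e => [|j w IH] e e0.
  by exists 1 => // h' _ _ t _ /=; rewrite subrr normr0 ltW.
have cW := continuous_word_integral T M h T0 ih w.
have [B B0 WB] := continuous_bounded_on _ _ (@segment_compact _ 0 T) cW.
pose I := \int[mu]_(s in `[0, T]) `|h j s|.
have I0 : 0 <= I by exact: Rintegral_ge0.
have I1 : 0 < I + 1 by rewrite ltr_wpDl.
have ea0 : 0 < e / 2 / (I + 1) by rewrite !divr_gt0.
have [eta eta0 etaP] := IH _ ea0.
have eB0 : 0 < e / 2 / B by rewrite !divr_gt0.
exists (Num.min eta (Num.min 1 (e / 2 / B))); first by rewrite !lt_min eta0 ltr01 eB0.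
move=> h' ih' hh' t tT.
have /andP[t0 tT'] : 0 <= t <= T by rewrite in_itv/= in tT.
have hh1 k : \int[mu]_(s in `[0, T]) `|h k s - h' k s| <= eta.
  by apply: le_trans (hh' k) _; rewrite ge_min lexx.
have hh2 : \int[mu]_(s in `[0, T]) `|h j s - h' j s| <= 1.
  by apply: le_trans (hh' j) _; rewrite !ge_min lexx ?orbT.
have hh3 : \int[mu]_(s in `[0, T]) `|h j s - h' j s| <= e / 2 / B.
  by apply: le_trans (hh' j) _; rewrite !ge_min lexx ?orbT.
have {}etaP := etaP h' ih' hh1.
have cW' := continuous_word_integral T M h' T0 ih' w.
have iWh := continuous_integrableM _ _ _ _ cW (ih j).
have iWh' := continuous_integrableM _ _ _ _ cW' (ih' j).
have id : mu.-integrable `[0, T] (EFin \o (fun s => h j s - h' j s)).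
  exact: integrable_sub.
have ind : mu.-integrable `[0, T] (EFin \o (fun s => `|h j s - h' j s|)).
  exact: integrable_norm.
have inh' : mu.-integrable `[0, T] (EFin \o (fun s => `|h' j s|)).
  exact: integrable_norm.
have inh : mu.-integrable `[0, T] (EFin \o (fun s => `|h j s|)).
  exact: integrable_norm.
have I' : \int[mu]_(s in `[0, T]) `|h' j s| <= I + 1.
  apply: (@le_trans _ _ (\int[mu]_(s in `[0, T]) (`|h j s| + `|h j s - h' j s|))).
    apply: le_Rintegral => //; first exact: integrable_add.
    move=> s _; rewrite [X in `|X|](_ : h' j s = h j s - (h j s - h' j s)); last by ring.
    exact: ler_normB.
  by rewrite RintegralD// lerD2l.
have iWht := integrable_segmentS _ _ _ _ _ (lexx 0) tT' iWh.
have iWht' := integrable_segmentS _ _ _ _ _ (lexx 0) tT' iWh'.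
rewrite /= -RintegralB//.
have iL : mu.-integrable `[0, T] (EFin \o (fun s =>
    word_integral M h w s * h j s - word_integral M h' w s * h' j s)).
  exact: integrable_sub.
apply: (@le_trans _ _ (\int[mu]_(s in `[0, t])
   (B * `|h j s - h' j s| + e / 2 / (I + 1) * `|h' j s|))).
  rewrite (le_trans (le_normr_Rintegral _ _))//.
    exact: integrable_segmentS iL.
  apply: le_Rintegral => //.
  - by apply: integrable_norm; exact: integrable_segmentS iL.
  - by apply: integrable_add => //; apply: integrable_scale => //;
      apply: (integrable_segmentS _ 0 T).
  - move=> s /=; rewrite in_itv/= => /andP[s0 st].
    have sT : s \in `[0, T] by rewrite in_itv/= s0 (le_trans st).
    rewrite [X in `|X|](_ : _ = word_integral M h w s * (h j s - h' j s) +
       (word_integral M h w s - word_integral M h' w s) * h' j s); last by ring.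
    rewrite (le_trans (ler_normD _ _))// !normrM lerD// ler_wpM2r//.
      exact: WB.
    exact: etaP.
have sub_t (f : R -> R) : mu.-integrable `[0, T] (EFin \o f) ->
    (forall s, 0 <= f s) ->
    \int[mu]_(s in `[0, t]) f s <= \int[mu]_(s in `[0, T]) f s.
  move=> if_ f0; rewrite -subr_ge0 (Rintegral_segmentB _ 0 T)//.
  by apply: Rintegral_ge0 => s _.
have i1 : mu.-integrable `[0, T] (EFin \o (fun s => B * `|h j s - h' j s|)).
  exact: integrable_scale.
have i2 : mu.-integrable `[0, T]
    (EFin \o (fun s => e / 2 / (I + 1) * `|h' j s|)).
  exact: integrable_scale.
apply: (le_trans (sub_t _ _ _)).
- exact: integrable_add.
- by move=> s; rewrite addr_ge0// mulr_ge0// ltW.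
rewrite RintegralD// !RintegralZl// [leRHS]splitr lerD//.
  by rewrite mulrC -ler_pdivlMr.
by rewrite mulrAC ler_pdivrMr// ler_wpM2l// ltW// divr_gt0.
Qed.

End joint_continuity.

Section solutions.
Context {R : realType}.
Local Notation mu := (@lebesgue_measure R).
Variables (T : R) (T0 : 0 <= T).
Local Notation D := (`[0, T]%classic).

(** Uniform continuity on [0, T] for the Euclidean norm, in epsilon-delta form
    because the topology of matrices comes from the sup norm. *)
Definition enorm_continuous_on n (x : R -> 'cV[R]_n) := forall e : R, 0 < e ->
  exists2 delta, 0 < delta & forall s t, s \in `[0, T] -> t \in `[0, T] ->
    `|s - t| < delta -> enorm (x s - x t) < e.

Lemma absolutely_continuous_enorm n (x : R -> 'cV[R]_n) :
  absolutely_continuous_on 0 T x -> enorm_continuous_on n x.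
Proof.
move=> ac e e0; have [d d0 dx] := ac e e0; exists d => //.
have le_case s t : s \in `[0, T] -> t \in `[0, T] -> s <= t -> `|s - t| < d ->
    enorm (x t - x s) < e.
  rewrite !in_itv/= => /andP[s0 sT] /andP[t0 tT] st std.
  have := dx 1%N (fun=> (s, t)); rewrite !big_ord1/=; apply.
  - by move=> k _; rewrite s0 st tT.
  - by move=> [|i] [|k].
  - by rewrite distrC ger0_norm ?subr_ge0 in std.
move=> s t sT tT std; case: (leP s t) => [|/ltW] st.
  by rewrite enormB; exact: le_case.
by apply: le_case => //; rewrite distrC.
Qed.

Lemma lipschitz_along_continuous n (x : R -> 'cV[R]_n) (G : R -> R) (L : R) :
  0 < L -> enorm_continuous_on n x ->
  (forall s t, s \in `[0, T] -> t \in `[0, T] ->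
     `|G s - G t| <= L * enorm (x s - x t)) ->
  {within D, continuous G}.
Proof.
move=> L0 cx GL; apply/subspace_continuousP => s sT.
apply/cvgrPdist_lt => e e0; have [d d0 dx] := cx _ (divr_gt0 e0 L0).
rewrite near_withinE; apply/nbhs_ballP; exists d => // t std tT.
have {}std : `|s - t| < d by [].
apply: le_lt_trans (GL _ _ sT tT) _.
by rewrite mulrC -ltr_pdivlMr// dx.
Qed.

Lemma enorm_continuousB n (x z : R -> 'cV[R]_n) : enorm_continuous_on n x ->
  enorm_continuous_on n z -> enorm_continuous_on n (fun s => x s - z s).
Proof.
move=> cx cz e e0; have e2 : 0 < e / 2 by rewrite divr_gt0.
have [d d0 dx] := cx _ e2; have [d' d'0 dz] := cz _ e2.
exists (Num.min d d'); first by rewrite lt_min d0.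
move=> s t sT tT; rewrite lt_min => /andP[std std'].
rewrite (_ : _ - _ = (x s - x t) - (z s - z t)).
  apply: le_lt_trans (enormD _ _) _.
  by rewrite enormN [ltRHS]splitr ltrD ?dx ?dz.
by rewrite !opprD !opprK addrACA.
Qed.

Lemma continuous_enorm_along n (x : R -> 'cV[R]_n) : enorm_continuous_on n x ->
  {within D, continuous (fun s => enorm (x s))}.
Proof.
move=> cx; apply: (lipschitz_along_continuous n x _ 1) => // s t _ _.
by rewrite mul1r enorm_dist.
Qed.

Variables (d m : nat) (x0 : 'cV[R]_d) (f0 : 'cV[R]_d -> 'cV[R]_d)
  (f : 'cV[R]_d -> 'M[R]_(d, m)) (L : R).
Hypothesis L0 : 0 < L.
Hypothesis f0L : forall i a b, `|f0 a i 0 - f0 b i 0| <= L * enorm (a - b).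
Hypothesis fL : forall i j a b, `|f a i j - f b i j| <= L * enorm (a - b).
Implicit Types (u v : L2 T m) (x z : R -> 'cV[R]_d).
Local Notation solution := (is_solution T x0 f0 f).

Lemma continuous_f_along x i j : enorm_continuous_on d x ->
  {within D, continuous (fun s => f (x s) i j)}.
Proof.
by move=> cx; apply: (lipschitz_along_continuous d x _ L) => // s t _ _; exact: fL.
Qed.

Lemma continuous_f0_along x i : enorm_continuous_on d x ->
  {within D, continuous (fun s => f0 (x s) i 0)}.
Proof.
by move=> cx; apply: (lipschitz_along_continuous d x _ L) => // s t _ _; exact: f0L.
Qed.

Lemma integrable_f_control x u i j : enorm_continuous_on d x ->
  mu.-integrable D (EFin \o (fun s => f (x s) i j * u s j 0)).
Proof.
move=> cx; apply: continuous_integrableM; first exact: continuous_f_along.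
exact: L2_integrable.
Qed.

(** Difference of two solutions, with the perturbation of the control isolated
    in the last sum. *)
Lemma solution_difference u v x z : solution u x -> solution v z ->
  forall i t, t \in `[0, T] ->
  x t i 0 - z t i 0 =
    \int[mu]_(s in `[0, t]) ((f0 (x s) i 0 - f0 (z s) i 0) +
       \sum_j (f (x s) i j - f (z s) i j) * v s j 0) +
    \sum_j \int[mu]_(s in `[0, t]) (f (x s) i j * (u s j 0 - v s j 0)).
Proof.
move=> [acx xE] [acz zE] i t tT.
have cx := absolutely_continuous_enorm _ _ acx.
have cz := absolutely_continuous_enorm _ _ acz.
have /andP[t0 tT'] : 0 <= t <= T by rewrite in_itv/= in tT.
have sub (h : R -> R) : mu.-integrable D (EFin \o h) ->
    mu.-integrable `[0, t] (EFin \o h) by exact: integrable_segmentS.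
have if0x := sub _ (continuous_integrable_segment _ _ _ (continuous_f0_along x i cx)).
have if0z := sub _ (continuous_integrable_segment _ _ _ (continuous_f0_along z i cz)).
have ixu j := sub _ (integrable_f_control x u i j cx).
have ixv j := sub _ (integrable_f_control x v i j cx).
have izv j := sub _ (integrable_f_control z v i j cz).
have isum (g : R -> 'cV[R]_d) (w : L2 T m) :
    (forall j, mu.-integrable `[0, t] (EFin \o (fun s => f (g s) i j * w s j 0))) ->
    mu.-integrable `[0, t] (EFin \o (fun s => \sum_j f (g s) i j * w s j 0)).
  by move=> ig; apply: integrable_sum_real.
have iu := isum _ _ ixu; have iv := isum _ _ ixv; have iz := isum _ _ izv.
have sumE (k : R -> 'I_m -> R) :
    (forall j, mu.-integrable `[0, t] (EFin \o (k ^~ j))) ->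
    \sum_j \int[mu]_(s in `[0, t]) k s j = \int[mu]_(s in `[0, t]) \sum_j k s j.
  move=> ik; rewrite /Rintegral.
  under [in RHS]eq_integral do rewrite -sumEFin.
  rewrite integral_sum//.
  by rewrite -sum_fine// => j _; apply: integrable_fin_num => //; exact: ik.
rewrite xE// zE// !mxE.
have -> : \int[mu]_(s in `[0, t]) (f0 (x s) + f (x s) *m u s) i 0 =
    \int[mu]_(s in `[0, t]) (f0 (x s) i 0 + \sum_j f (x s) i j * u s j 0).
  by apply: eq_Rintegral => s _; rewrite !mxE.
have -> : \int[mu]_(s in `[0, t]) (f0 (z s) + f (z s) *m v s) i 0 =
    \int[mu]_(s in `[0, t]) (f0 (z s) i 0 + \sum_j f (z s) i j * v s j 0).
  by apply: eq_Rintegral => s _; rewrite !mxE.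
rewrite addrAC opprD addrA subrr add0r addrC.
have ixuv j : mu.-integrable `[0, t]
    (EFin \o (fun s => f (x s) i j * (u s j 0 - v s j 0))).
  rewrite (_ : (fun s => _) =
    (fun s => f (x s) i j * u s j 0 - f (x s) i j * v s j 0)).
    exact: integrable_sub.
  by apply/funext => s; rewrite mulrBr.
have ixzv j : mu.-integrable `[0, t]
    (EFin \o (fun s => (f (x s) i j - f (z s) i j) * v s j 0)).
  rewrite (_ : (fun s => _) =
    (fun s => f (x s) i j * v s j 0 - f (z s) i j * v s j 0)).
    exact: integrable_sub.
  by apply/funext => s; rewrite mulrBl.
rewrite sumE//.
have iux : mu.-integrable `[0, t]
    (EFin \o (fun s => f0 (x s) i 0 + \sum_j f (x s) i j * u s j 0)).
  exact: integrable_add.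
have ivz : mu.-integrable `[0, t]
    (EFin \o (fun s => f0 (z s) i 0 + \sum_j f (z s) i j * v s j 0)).
  exact: integrable_add.
rewrite -RintegralB//.
rewrite -RintegralD//.
- apply: eq_Rintegral => s _.
  under [X in _ = _ + X + _]eq_bigr do rewrite mulrBl.
  under [X in _ = _ + X]eq_bigr do rewrite mulrBr.
  by rewrite !sumrB; ring.
- apply: integrable_add => //; first exact: integrable_sub.
  exact: integrable_sum_real.
- exact: integrable_sum_real.
Qed.

Lemma integrable_drift v x z i : enorm_continuous_on d x ->
  enorm_continuous_on d z -> mu.-integrable D (EFin \o (fun s =>
    (f0 (x s) i 0 - f0 (z s) i 0) + \sum_j (f (x s) i j - f (z s) i j) * v s j 0)).
Proof.
move=> cx cz.
have i0x := continuous_integrable_segment _ _ _ (continuous_f0_along x i cx).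
have i0z := continuous_integrable_segment _ _ _ (continuous_f0_along z i cz).
apply: integrable_add => //; first exact: integrable_sub.
apply: integrable_sum_real => // j.
have ix := integrable_f_control x v i j cx.
have iz := integrable_f_control z v i j cz.
rewrite (_ : (fun s => _) =
  (fun s => f (x s) i j * v s j 0 - f (z s) i j * v s j 0)).
  exact: integrable_sub.
by apply/funext => s; rewrite mulrBl.
Qed.

Lemma drift_le v (a b : 'cV[R]_d) i s :
  `|(f0 a i 0 - f0 b i 0) + \sum_j (f a i j - f b i j) * v s j 0| <=
  L * enorm (a - b) * (1 + m%:R * enorm (v s)).
Proof.
rewrite (le_trans (ler_normD _ _))// mulrDr mulr1 lerD//.
rewrite (le_trans (ler_norm_sum _ _ _))//.
apply: (@le_trans _ _ (\sum_(j < m) L * enorm (a - b) * enorm (v s))).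
  by apply: ler_sum => j _; rewrite normrM ler_pM// entry_le_enorm.
by rewrite sumr_const card_ord -[leLHS]mulr_natl mulrCA.
Qed.

(** The weight of the Gronwall inequality satisfied by the difference of two
    solutions. *)
Definition gronwall_weight v s : R := d%:R * L * (1 + m%:R * enorm (v s)).

Lemma gronwall_weight_ge0 v s : 0 <= gronwall_weight v s.
Proof.
apply: mulr_ge0; first by apply: mulr_ge0 => //; exact: ltW.
by apply: addr_ge0 => //; apply: mulr_ge0 => //; exact: enorm_ge0.
Qed.

Lemma gronwall_weight_integrable v :
  mu.-integrable D (EFin \o gronwall_weight v) /\
  mu.-integrable D (EFin \o (fun s => gronwall_weight v s ^+ 2)).
Proof.
have i0 := integrable_segment_cst 0 T 1.
have i1 : mu.-integrable D (EFin \o (fun s => m%:R * enorm (v s))).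
  by apply: integrable_scale => //; exact: L2_enorm_integrable.
have i2 : mu.-integrable D (EFin \o (fun s => m%:R ^+ 2 * enorm (v s) ^+ 2)).
  by apply: integrable_scale => //; exact: L2_sqr_integrable.
split.
  apply: integrable_scale => //; exact: integrable_add.
rewrite (_ : (fun s => _) = (fun s => (d%:R * L) ^+ 2 *
  (1 + 2 * (m%:R * enorm (v s)) + m%:R ^+ 2 * enorm (v s) ^+ 2))).
  apply: integrable_scale => //; apply: integrable_add => //.
  by apply: integrable_add => //; exact: integrable_scale.
by apply/funext => s; rewrite /gronwall_weight; ring.
Qed.

Lemma gronwall_weight_sqr_le v (N : R) :
  \int[mu]_(s in D) enorm (v s) ^+ 2 <= N ->
  \int[mu]_(s in D) gronwall_weight v s ^+ 2 <=
    (d%:R * L) ^+ 2 * (2 * T + 2 * m%:R ^+ 2 * N).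
Proof.
move=> vN; have i0 := integrable_segment_cst 0 T 2.
have i2 : mu.-integrable D (EFin \o (fun s => 2 * m%:R ^+ 2 * enorm (v s) ^+ 2)).
  by apply: integrable_scale => //; exact: L2_sqr_integrable.
have i3 : mu.-integrable D
    (EFin \o (fun s => 2 + 2 * m%:R ^+ 2 * enorm (v s) ^+ 2)).
  exact: integrable_add.
have [_ iw] := gronwall_weight_integrable v.
apply: (@le_trans _ _ (\int[mu]_(s in D)
    ((d%:R * L) ^+ 2 * (2 + 2 * m%:R ^+ 2 * enorm (v s) ^+ 2)))).
  apply: le_Rintegral => //; first exact: integrable_scale.
  move=> s _; rewrite exprMn ler_wpM2l ?sqr_ge0//.
  by have := sqr_ge0 (1 - m%:R * enorm (v s)); rewrite !sqrrD sqrrN exprMn; lra.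
rewrite RintegralZl// ler_wpM2l ?sqr_ge0// RintegralD//.
rewrite Rintegral_segment_cst// lerD2l RintegralZl//; last exact: L2_sqr_integrable.
by rewrite ler_wpM2l// mulr_ge0// sqr_ge0.
Qed.

(** Only the integrals of [f (x s)] against the perturbation of the control
    enter the bound. This makes the lemma give both the dependence of the
    solution on the primitive of its control and its continuity in L^2. *)
Lemma solution_stable u v x z (t a B : R) : t \in `[0, T] ->
  solution u x -> solution v z ->
  (forall r, r \in `[0, t] -> \sum_i \sum_j
     `|\int[mu]_(s in `[0, r]) (f (x s) i j * (u s j 0 - v s j 0))| <= a) ->
  0 < B -> \int[mu]_(s in D) gronwall_weight v s ^+ 2 <= B ->
  enorm (x t - z t) <= 2 * a * expR (2 * B * t).
Proof.
move=> tT solx solz pert B0 wB.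
have /andP[t0 tT'] : 0 <= t <= T by rewrite in_itv/= in tT.
have cx := absolutely_continuous_enorm _ _ solx.1.
have cz := absolutely_continuous_enorm _ _ solz.1.
have cphi := continuous_enorm_along _ _ (enorm_continuousB _ _ _ cx cz).
have [iw iw2] := gronwall_weight_integrable v.
have sub (h : R -> R) r : r <= T -> mu.-integrable D (EFin \o h) ->
    mu.-integrable `[0, r] (EFin \o h) by move=> rT; exact: integrable_segmentS.
apply: (gronwall_L2 t a B (fun s => enorm (x s - z s)) (gronwall_weight v)) => //.
- exact: continuous_segmentS cphi.
- by move=> s _; exact: enorm_ge0.
- by move=> s _; exact: gronwall_weight_ge0.
- exact: sub.
- exact: sub.
- apply: le_trans wB; rewrite -subr_ge0 (Rintegral_segmentB _ 0 T)//.
  by apply: Rintegral_ge0 => s _; exact: sqr_ge0.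
- move=> r rt; have /andP[r0 rt'] : 0 <= r <= t by rewrite in_itv/= in rt.
  have rT' : r <= T := le_trans rt' tT'.
  have rT : r \in `[0, T] by rewrite in_itv/= r0.
  have iphiw := sub _ _ rT' (continuous_integrableM _ _ _ _ cphi iw).
  pose c s := L * enorm (x s - z s) * (1 + m%:R * enorm (v s)).
  have ic : mu.-integrable `[0, r] (EFin \o c).
    apply: sub => //; rewrite (_ : c = (fun s =>
        enorm (x s - z s) * (L * (1 + m%:R * enorm (v s))))).
      apply: continuous_integrableM => //; apply: integrable_scale => //.
      apply: integrable_add => //; first exact: integrable_segment_cst.
      by apply: integrable_scale => //; exact: L2_enorm_integrable.
    by apply/funext => s; rewrite /c; ring.
  apply: le_trans (enorm_le_sum _ _) _.
  apply: (@le_trans _ _ (\sum_(i < d) (\int[mu]_(s in `[0, r]) c s + \sum_j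
     `|\int[mu]_(s in `[0, r]) (f (x s) i j * (u s j 0 - v s j 0))|))).
    apply: ler_sum => i _; rewrite !mxE (solution_difference u v)//.
    rewrite (le_trans (ler_normD _ _))// lerD ?ler_norm_sum//.
    have id := sub _ _ rT' (integrable_drift v x z i cx cz).
    rewrite (le_trans (le_normr_Rintegral _ _))//.
    apply: le_Rintegral => //; first exact: integrable_norm.
    by move=> s _; exact: drift_le.
  rewrite big_split/= addrC lerD ?pert// sumr_const card_ord -[leLHS]mulr_natl -RintegralZl//.
  rewrite le_eqVlt; apply/orP; left; apply/eqP; apply: eq_Rintegral => s _.
  by rewrite /c /gronwall_weight; ring.
- by rewrite in_itv/= t0 lexx.
Qed.

(** A solution at time [t] only depends on the primitive of its control. *)
Lemma solution_unique u v x z (t : R) : t \in `[0, T] ->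
  solution u x -> solution v z ->
  (forall j r, r \in `[0, t] -> \int[mu]_(s in `[0, r]) (u s j 0 - v s j 0) = 0) ->
  x t = z t.
Proof.
move=> tT solx solz uv0.
have /andP[t0 tT'] : 0 <= t <= T by rewrite in_itv/= in tT.
have cx := absolutely_continuous_enorm _ _ solx.1.
pose B := \int[mu]_(s in D) gronwall_weight v s ^+ 2.
have B0 : 0 <= B by apply: Rintegral_ge0 => s _; exact: sqr_ge0.
have : enorm (x t - z t) <= 2 * 0 * expR (2 * (B + 1) * t).
  apply: (solution_stable u v) => //; rewrite ?ltr_wpDl ?lerDl//.
  move=> r rt; have /andP[r0 rt'] : 0 <= r <= t by rewrite in_itv/= in rt.
  rewrite big1// => i _; rewrite big1// => j _.
  rewrite primitive_eq0_Rintegral ?normr0//.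
  - apply: integrable_sub => //; apply: (integrable_segmentS _ 0 T);
      rewrite ?(le_trans rt')//; exact: L2_integrable.
  - move=> s sr; apply: uv0; move: sr; rewrite !in_itv/= => /andP[-> /le_trans]; exact.
  - apply: continuous_segmentS (continuous_f_along x i j cx) => //.
    exact: le_trans tT'.
rewrite mulr0 mul0r => xz0; apply/colP => i; apply/eqP.
rewrite -subr_eq0 -normr_le0 (le_trans _ xz0)//.
by have := entry_le_enorm _ (x t - z t) i; rewrite !mxE.
Qed.

(** Continuity in the control, uniformly in time: near [u] the weights of the
    Gronwall inequality have uniformly bounded L^2 norms. *)
Lemma solution_continuous (x : L2 T m -> R -> 'cV[R]_d) :
  (forall u : L2 T m, solution u (x u)) ->
  forall u (e : R), 0 < e -> exists2 N, nbhs u N &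
    forall v t, N v -> t \in `[0, T] -> enorm (x u t - x v t) <= e.
Proof.
move=> sol u e e0.
have cx := absolutely_continuous_enorm _ _ (sol u).1.
pose N2 := 2 * (\int[mu]_(s in D) enorm (u s) ^+ 2 + 1).
pose B := (d%:R * L) ^+ 2 * (2 * T + 2 * m%:R ^+ 2 * N2) + 1.
have N20 : 0 <= N2.
  by rewrite mulr_ge0// addr_ge0// Rintegral_ge0// => s _; exact: sqr_ge0.
have B0 : 0 < B.
  rewrite ltr_wpDl//; apply: mulr_ge0; first exact: sqr_ge0.
  apply: addr_ge0; first exact: mulr_ge0.
  by apply: mulr_ge0 => //; apply: mulr_ge0 => //; exact: sqr_ge0.
have bnd i j : {F : R | 0 < F & forall s, s \in `[0, T] -> `|f (x u s) i j| <= F}.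
  apply: cid2; exact: (continuous_bounded_on _ _ (@segment_compact _ 0 T)
    (continuous_f_along (x u) i j cx)).
pose F i j := s2val (bnd i j); pose S := \sum_i \sum_j F i j.
have F0 i j : 0 < F i j by exact: s2valP (bnd i j).
have S0 : 0 <= S by apply: sumr_ge0 => i _; apply: sumr_ge0 => j _; rewrite ltW.
pose C := 2 * (S + 1) * (1 + T) * expR (2 * B * T).
have T1 : 0 < 1 + T by rewrite ltr_pwDl.
have C0 : 0 < C by rewrite !mulr_gt0 ?expR_gt0// ltr_wpDl.
pose delta := Num.min 1 (e / C).
have delta0 : 0 < delta by rewrite lt_min ltr01 divr_gt0.
exists [set v : L2 T m | (L2norm T (fun t => u t - v t)%R < delta%:E)%E].
  exact: near_L2.
move=> v t /= uv tT.
have muv : forall i, measurable_fun D (fun t => (u t - v t) i 0).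
  by move=> i; exact: L2_sub_measurable.
have [iuv2 uv2] := L2norm_lt _ _ _ _ delta0 muv uv.
have iuv := integrable_of_sqr _ _ _ muv iuv2.
have uv1 := L2norm_lt_integral _ T0 _ _ _ delta0 muv uv.
have wB : \int[mu]_(s in D) gronwall_weight v s ^+ 2 <= B.
  apply: (@le_trans _ _ ((d%:R * L) ^+ 2 * (2 * T + 2 * m%:R ^+ 2 * N2))); last first.
    by rewrite lerDl.
  apply: gronwall_weight_sqr_le.
  have iu2 := L2_sqr_integrable T m u.
  have isum : mu.-integrable D
      (EFin \o (fun s => enorm (u s) ^+ 2 + enorm (u s - v s) ^+ 2)).
    exact: integrable_add.
  apply: (@le_trans _ _ (\int[mu]_(s in D)
     (2 * (enorm (u s) ^+ 2 + enorm (u s - v s) ^+ 2)))).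
    apply: le_Rintegral => //; [exact: L2_sqr_integrable|exact: integrable_scale|].
    move=> s _.
    have vs : enorm (v s) <= enorm (u s) + enorm (u s - v s).
      rewrite -[X in enorm X <= _](subKr (u s)).
      by rewrite (le_trans (enormD _ _))// enormN.
    have := enorm_ge0 (v s); have := sqr_ge0 (enorm (u s) - enorm (u s - v s)).
    by nra.
  rewrite RintegralZl// RintegralD// /N2 ler_wpM2l// lerD2l (le_trans uv2)//.
  by apply: exprn_ile1; [exact: ltW|rewrite ge_min lexx].
have /andP[t0 tT'] : 0 <= t <= T by rewrite in_itv/= in tT.
have : enorm (x u t - x v t) <= 2 * (S * (delta * (1 + T))) * expR (2 * B * t).
  apply: (solution_stable u v) => // r rt.
  have /andP[r0 rt'] : 0 <= r <= t by rewrite in_itv/= in rt.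
  have rT := le_trans rt' tT'.
  rewrite /S mulr_suml; apply: ler_sum => i _.
  rewrite mulr_suml; apply: ler_sum => j _.
  have iuvj : mu.-integrable D (EFin \o (fun s => u s j 0 - v s j 0)).
    by apply: integrable_sub => //; exact: L2_integrable.
  have ifuv := integrable_segmentS _ _ _ _ _ (lexx 0) rT (continuous_integrableM _ _ _ _
    (continuous_f_along (x u) i j cx) iuvj).
  have iFr : mu.-integrable `[0, r] (EFin \o (fun s => enorm (u s - v s))).
    exact: (integrable_segmentS _ 0 T).
  apply: (@le_trans _ _ (\int[mu]_(s in `[0, r]) (F i j * enorm (u s - v s)))).
    rewrite (le_trans (le_normr_Rintegral _ _))//.
    apply: le_Rintegral => //; [exact: integrable_norm|exact: integrable_scale|].
    move=> s; rewrite /= in_itv/= => /andP[s0 sr]; rewrite normrM ler_pM//.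
      by apply: (s2valP' (bnd i j)); rewrite in_itv/= s0 (le_trans sr).
    by have := entry_le_enorm _ (u s - v s) j; rewrite !mxE.
  rewrite RintegralZl//; apply: ler_wpM2l; first exact: ltW.
  apply: le_trans uv1.
  rewrite -subr_ge0 (Rintegral_segmentB _ 0 T)//.
  by apply: Rintegral_ge0 => s _; exact: enorm_ge0.
move=> /le_trans; apply.
have dC : delta * C <= e by rewrite -ler_pdivlMr// ge_min lexx orbT.
apply: le_trans dC; rewrite /C.
have E1 : expR (2 * B * t) <= expR (2 * B * T).
  by rewrite ler_expR ler_wpM2l// mulr_ge0// ltW.
have -> : delta * (2 * (S + 1) * (1 + T) * expR (2 * B * T)) =
   2 * ((S + 1) * (delta * (1 + T))) * expR (2 * B * T) by ring.
have p0 : 0 <= delta * (1 + T) by rewrite mulr_ge0 ?ltW.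
apply: ler_pM; rewrite ?expR_ge0//; first by rewrite mulr_ge0// mulr_ge0.
by rewrite ler_wpM2l// ler_wpM2r// lerDl.
Qed.

End solutions.

(** * Universality of the signature *)

Section augmented_control.
Context {R : realType}.
Local Notation mu := (@lebesgue_measure R).
Variables (T : R) (m : nat).
Hypothesis T0 : 0 <= T.
Implicit Types u v : L2 T m.
Local Notation D := (`[0, T]%classic).

(** The density of the time-augmented path: time has density 1. *)
Definition augmented_control u (j : 'I_m.+1) (s : R) : R :=
  (col_mx (const_mx 1 : 'cV[R]_1) (u s) : 'cV[R]_(1 + m)) j 0.

Lemma augmented_control0 u : augmented_control u ord0 = cst 1.
Proof.
apply/funext => s; rewrite /augmented_control.
rewrite (_ : ord0 = lshift m (ord0 : 'I_1)); last exact: val_inj.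
by rewrite col_mxEu mxE.
Qed.

Lemma augmented_controlS u (j : 'I_m) :
  augmented_control u (rshift 1 j) = fun s => u s j 0.
Proof. by apply/funext => s; rewrite /augmented_control col_mxEd. Qed.

Lemma augmented_indexP (j : 'I_m.+1) : j = ord0 \/ exists k : 'I_m, j = rshift 1 k.
Proof.
have [k ->|k ->] := split_ordP (j : 'I_(1 + m)).
  by left; apply: val_inj; rewrite /= ord1.
by right; exists k.
Qed.

Lemma augmented_control_integrable u j :
  mu.-integrable D (EFin \o augmented_control u j).
Proof.
have [->|[k ->]] := augmented_indexP j.
  by rewrite augmented_control0; exact: integrable_segment_cst.
by rewrite augmented_controlS; exact: L2_integrable.
Qed.

Lemma time_augmentedE u s j : s \in `[0, T] ->
  time_augmented u s j 0 = \int[mu]_(x in `[0, s]) augmented_control u j x.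
Proof.
rewrite in_itv/= => /andP[s0 _]; have [->|[k ->]] := augmented_indexP j.
  rewrite augmented_control0 Rintegral_segment_cst// mul1r.
  have -> : (ord0 : 'I_m.+1) = lshift m (ord0 : 'I_1) by exact: val_inj.
  by rewrite [LHS]col_mxEu mxE.
by rewrite augmented_controlS [LHS]col_mxEd mxE.
Qed.

Lemma word_integral_time u k s : 0 <= s ->
  word_integral m.+1 (augmented_control u) (nseq k ord0) s = s ^+ k / k`!%:R.
Proof.
elim: k s => [|k IH] s s0; first by rewrite expr0 fact0 divr1.
have iX : mu.-integrable `[0, s] (EFin \o (fun x : R => x ^+ k)).
  apply: continuous_integrable_segment; apply: continuous_subspaceT.
  exact: exprn_continuous.
rewrite [LHS]/= augmented_control0.
transitivity (\int[mu]_(x in `[0, s]) (k`!%:R^-1 * x ^+ k)).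
  apply: eq_Rintegral => x; rewrite inE/= in_itv/= => /andP[x0 _].
  by rewrite IH// mulr1 mulrC.
rewrite RintegralZl// Rintegral_exprn// factS natrM invfM; ring.
Qed.

(** Words made of a spatial letter followed by time letters compute, up to a
    factorial, the moments of the corresponding coordinate of the control. *)
Lemma word_integral_moment u (j : 'I_m) k t : t \in `[0, T] ->
  k`!%:R * word_integral m.+1 (augmented_control u) (rshift 1 j :: nseq k ord0) t =
  \int[mu]_(s in `[0, t]) (s ^+ k * u s j 0).
Proof.
rewrite in_itv/= => /andP[t0 tT].
have iXu : mu.-integrable `[0, t] (EFin \o (fun s => s ^+ k * u s j 0)).
  apply: continuous_integrableM.
    by apply: continuous_subspaceT; exact: exprn_continuous.
  by apply: (integrable_segmentS _ 0 T) => //; exact: L2_integrable.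
rewrite [X in _ * X](_ : _ = \int[mu]_(s in `[0, t])
   (k`!%:R^-1 * (s ^+ k * u s j 0))).
  by rewrite RintegralZl// mulrA divff ?mul1r// pnatr_eq0 -lt0n fact_gt0.
rewrite [LHS]/= augmented_controlS; apply: eq_Rintegral => s.
rewrite inE/= in_itv/= => /andP[s0 _].
by rewrite word_integral_time//; ring.
Qed.

Lemma augmented_control_dist u v j (e : R) : 0 < e ->
  (L2norm T (fun t => u t - v t)%R < e%:E)%E ->
  \int[mu]_(s in `[0, T]) `|augmented_control u j s - augmented_control v j s| <=
    e * (1 + T).
Proof.
move=> e0 uv; have [->|[k ->]] := augmented_indexP j.
  rewrite (_ : (fun s => _) = cst 0); last first.
    by apply/funext => s; rewrite !augmented_control0 /= subrr normr0.
  rewrite Rintegral_cst// mul0r.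
  by rewrite mulr_ge0 ?addr_ge0// ltW.
rewrite !augmented_controlS.
have muv i : measurable_fun D (fun t => (u t - v t) i 0).
  exact: L2_sub_measurable.
have [iuv2 _] := L2norm_lt _ _ _ _ e0 muv uv.
apply: le_trans (L2norm_lt_integral _ T0 _ _ _ e0 muv uv).
apply: le_Rintegral => //.
- by apply: integrable_norm; apply: integrable_sub => //; exact: L2_integrable.
- exact: integrable_of_sqr iuv2.
- by move=> s _; have := entry_le_enorm _ (u s - v s) k; rewrite !mxE.
Qed.

Lemma continuous_word_integral_control (K : set (L2 T m)) w :
  {within `[0, T] `*` K, continuous (fun p : R * L2 T m =>
     word_integral m.+1 (augmented_control p.2) w p.1)}.
Proof.
apply: (joint_continuity (L2 T m) T K
  (fun t u => word_integral m.+1 (augmented_control u) w t)).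
  by move=> u; apply: continuous_word_integral => // j; exact: augmented_control_integrable.
move=> u e e0; have e2 : 0 < e / 2 by rewrite divr_gt0.
have [eta eta0 etaP] := word_integral_stable T m.+1 _ w _ T0
  (augmented_control_integrable u) e2.
have T1 : 0 < 1 + T by rewrite ltr_pwDl.
have d0 : 0 < eta / (1 + T) by rewrite divr_gt0.
exists [set v : L2 T m |
  (L2norm T (fun t => u t - v t)%R < (eta / (1 + T))%:E)%E]; first exact: near_L2.
move=> v t /= uv tT; apply: (@le_lt_trans _ _ (e / 2)); last first.
  by rewrite ltr_pdivrMr// ltr_pMr// ltr1n.
apply: etaP tT => [j|j]; first exact: augmented_control_integrable.
by rewrite (le_trans (augmented_control_dist u v j _ d0 uv))// divfK// gt_eqF.
Qed.

Lemma continuous_signature_functional (K : set (L2 T m)) g :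
  signature_functional T m.+1 (fun u : L2 T m => time_augmented u) g ->
  {within `[0, T] `*` K, continuous g}.
Proof.
move=> Ag; have [r gr] := signature_functional_expand T m.+1 augmented_control _ T0
  augmented_control_integrable time_augmentedE g Ag.
apply: (@subspace_eq_continuous _ _ _ (fun p : R * L2 T m => \sum_(cw <- r)
    cw.1 * word_integral m.+1 (augmented_control p.2) cw.2 p.1)).
  by move=> [t u]; rewrite inE => -[/= tT _]; rewrite /from_subspace gr.
elim: r {gr} => [|cw r IH].
  rewrite (_ : (fun _ => _) = cst 0); first by move=> p; exact: cvg_cst.
  by apply/funext => p; rewrite big_nil.
rewrite (_ : (fun _ => _) = (fun p : R * L2 T m => cw.1 *
    word_integral m.+1 (augmented_control p.2) cw.2 p.1 + \sum_(cw <- r)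
    cw.1 * word_integral m.+1 (augmented_control p.2) cw.2 p.1)); last first.
  by apply/funext => p; rewrite big_cons.
move=> p; apply: cvgD; last exact: IH.
apply: cvgM; first exact: cvg_cst.
exact: continuous_word_integral_control.
Qed.

(** The signature of the time-augmented path determines the time and, through
    the moments, the primitive of the control up to that time. *)
Lemma signature_determines u v t s : t \in `[0, T] -> s \in `[0, T] ->
  (forall g, signature_functional T m.+1 (fun u : L2 T m => time_augmented u) g ->
     g (t, u) = g (s, v)) ->
  t = s /\ forall j r, r \in `[0, t] ->
    \int[mu]_(x in `[0, r]) (u x j 0 - v x j 0) = 0.
Proof.
move=> tT sT sig.
have {}sig w : word_integral m.+1 (augmented_control u) w t =
    word_integral m.+1 (augmented_control v) w s.
  apply: (sig (fun p => word_integral m.+1 (augmented_control p.2) w p.1)).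
  apply: signature_functional_word T0 _ _ w.
    exact: augmented_control_integrable.
  exact: time_augmentedE.
have /andP[t0 tT'] : 0 <= t <= T by rewrite in_itv/= in tT.
have /andP[s0 sT'] : 0 <= s <= T by rewrite in_itv/= in sT.
have ts : t = s.
  have := sig (nseq 1 ord0); rewrite !word_integral_time//.
  by rewrite !expr1 (factS 0) fact0 muln1 !divr1.
split=> // j; move: sT sig s0 sT'; rewrite -{s}ts => _ sig _ _.
have iu : mu.-integrable `[0, t] (EFin \o (fun x => u x j 0)).
  by apply: (integrable_segmentS _ 0 T) => //; exact: L2_integrable.
have iv : mu.-integrable `[0, t] (EFin \o (fun x => v x j 0)).
  by apply: (integrable_segmentS _ 0 T) => //; exact: L2_integrable.
apply: moments_primitive_eq0 => // [|n]; first exact: integrable_sub.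
have cX : {within `[0, t], continuous (fun x : R => x ^+ n)}.
  by apply: continuous_subspaceT; exact: exprn_continuous.
have iXu := continuous_integrableM _ _ _ _ cX iu.
have iXv := continuous_integrableM _ _ _ _ cX iv.
transitivity (\int[mu]_(x in `[0, t]) (x ^+ n * u x j 0 - x ^+ n * v x j 0)).
  by apply: eq_Rintegral => x _; rewrite mulrBr.
by rewrite RintegralB// -!word_integral_moment// sig subrr.
Qed.

End augmented_control.

(** A Lipschitz bound for a norm that dominates the entries is one for each
    entry. *)
Lemma globally_lipschitz_entry (R : realType) n p q (N : 'M[R]_(p, q) -> R)
    (g : 'cV[R]_n -> 'M[R]_(p, q)) :
  (forall (A : 'M[R]_(p, q)) i j, `|A i j| <= N A) -> globally_lipschitz N g ->
  exists2 L : R, 0 < L & forall i j a b, `|g a i j - g b i j| <= L * enorm (a - b).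
Proof.
move=> Nentry [L L0 gL]; exists L => // i j a b.
apply: le_trans (gL a b); have := Nentry (g a - g b) i j.
by rewrite !mxE.
Qed.

Section output.
Context {R : realType}.
Variables (T : R) (d m p : nat) (x0 : 'cV[R]_d)
  (f0 : 'cV[R]_d -> 'cV[R]_d) (f : 'cV[R]_d -> 'M[R]_(d, m))
  (c : 'cV[R]_d -> 'cV[R]_p) (x : L2 T m -> R -> 'cV[R]_d) (L : R).
Hypothesis T0 : 0 <= T.
Hypothesis L0 : 0 < L.
Hypothesis f0L : forall i a b, `|f0 a i 0 - f0 b i 0| <= L * enorm (a - b).
Hypothesis fL : forall i j a b, `|f a i j - f b i j| <= L * enorm (a - b).
Hypothesis cL : locally_lipschitz enorm c.
Hypothesis sol : forall u : L2 T m, is_solution T x0 f0 f u (x u).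

(** Controls near [u] keep the state in a ball that is one unit larger than the
    one containing the trajectory of [u]; [c] is Lipschitz there. *)
Lemma continuous_output (K : set (L2 T m)) i : {within `[0, T] `*` K,
  continuous (fun q : R * L2 T m => c (x q.2 q.1) i 0)}.
Proof.
have cx u := absolutely_continuous_enorm _ _ _ (sol u).1.
have bx u : exists2 r : R, 0 < r & forall s, s \in `[0, T] -> enorm (x u s) <= r.
  have [r r0 xr] := continuous_bounded_on _ _ (@segment_compact _ 0 T)
    (continuous_enorm_along _ _ _ (cx u)).
  by exists r => // s sT; rewrite (le_trans (ler_norm _))// xr.
have cLi (k : R) a b l : enorm (c a - c b) <= k * l -> `|c a i 0 - c b i 0| <= k * l.
  by apply: le_trans; have := entry_le_enorm _ (c a - c b) i; rewrite !mxE.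
apply: (joint_continuity (L2 T m) T K (fun t u => c (x u t) i 0)).
  move=> u; have [r r0 xr] := bx u; have [k k0 ck] := cL r r0.
  apply: (lipschitz_along_continuous _ _ _ _ k k0 (cx u)) => s t sT tT.
  by apply: cLi; apply: ck; exact: xr.
move=> u e e0; have [r r0 xr] := bx u.
have [k k0 ck] := cL (r + 1) (ltr_wpDl (ltW r0) ltr01).
have e20 : 0 < e / 2 by rewrite divr_gt0.
have d0 : 0 < Num.min 1 (e / 2 / k) by rewrite lt_min ltr01 divr_gt0.
have [N Nu xN] := solution_continuous T T0 d m x0 f0 f L L0 f0L fL x sol u _ d0.
exists N => // v t Nv tT; have xuv := xN v t Nv tT.
have xv : enorm (x v t) <= r + 1.
  rewrite (_ : x v t = x u t - (x u t - x v t)); last by rewrite subKr.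
  rewrite (le_trans (enormD _ _))// enormN lerD ?xr// (le_trans xuv)//.
  by rewrite ge_min lexx.
have xu : enorm (x u t) <= r + 1 by rewrite (le_trans (xr t tT))// lerDl.
apply: (@le_lt_trans _ _ (e / 2)); last by rewrite ltr_pdivrMr// ltr_pMr// ltr1n.
apply: (le_trans (cLi _ _ _ _ (ck _ _ xu xv))).
rewrite mulrC -ler_pdivlMr// (le_trans xuv)//.
by rewrite ge_min lexx orbT.
Qed.

End output.

Theorem theorem3p10 (R : realType) (T : R) (d m p : nat) (x0 : 'cV[R]_d)
    (f0 : 'cV[R]_d -> 'cV[R]_d) (f : 'cV[R]_d -> 'M[R]_(d, m))
    (c : 'cV[R]_d -> 'cV[R]_p) (x : L2 T m -> R -> 'cV[R]_d)
    (K : set (L2 T m)) :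
  0 < T ->
  globally_lipschitz enorm f0 ->
  globally_lipschitz opnorm f ->
  locally_lipschitz enorm c ->
  (forall u : L2 T m, is_solution T x0 f0 f u (x u)) ->
  compact K ->
  forall (i : 'I_p) (eps : R), 0 < eps ->
    exists2 l : tensor_seq m.+1, Wspace l &
      (ereal_sup [set ereal_sup
         [set (`|c (x u t) i 0
                 - pairing l (signature (time_augmented u) 0 t)|)%:E | u in K]
       | t in `[0%R, T]] < eps%:E)%E.
Proof.
move=> /ltW T0 f0lip flip clip sol cK i eps eps0.
have [|La La0 f0L] := globally_lipschitz_entry _ _ _ _ enorm f0 _ f0lip.
  by move=> A k j; rewrite ord1; exact: entry_le_enorm.
have [|Lb Lb0 fL] := globally_lipschitz_entry _ _ _ _ opnorm f _ flip.
  by move=> A k j; exact: entry_le_opnorm.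
pose L := La + Lb; have L0 : 0 < L by exact: addr_gt0.
have {}f0L k a b : `|f0 a k 0 - f0 b k 0| <= L * enorm (a - b).
  by rewrite (le_trans (f0L k 0 a b))// ler_wpM2r ?enorm_ge0// lerDl ltW.
have {}fL k j a b : `|f a k j - f b k j| <= L * enorm (a - b).
  by rewrite (le_trans (fL k j a b))// ler_wpM2r ?enorm_ge0// lerDr ltW.
pose A := signature_functional T m.+1 (fun u : L2 T m => time_augmented u).
pose y (q : R * L2 T m) : R := c (x q.2 q.1) i 0.
have eps2 : 0 < eps / 2 by rewrite divr_gt0.
have ih := @augmented_control_integrable R T m.
have Xh := @time_augmentedE R T m.
have [||||||||g [l Wl gl] yg] := stone_weierstrass (`[0, T] `*` K) A _ _ _ _ _ _ y _ _ _ eps2.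
- by apply: compact_setX => //; exact: segment_compact.
- exact: signature_functional1 T0 ih Xh.
- by move=> a b; exact: signature_functionalD.
- by move=> k a; exact: signature_functionalZ.
- by move=> a b; exact: (signature_functionalM _ _ _ _ T0 ih Xh).
- by move=> a; exact: continuous_signature_functional.
- exact: (continuous_output T d m p x0 f0 f c x L).
- move=> [t u] [s v] [/= tT _] [/= sT _] sep.
  have [ts uv] := signature_determines _ _ T0 _ _ _ _ tT sT sep.
  rewrite /y /= -ts (solution_unique T d m x0 f0 f L L0 f0L fL u v (x u) (x v) t)//.
exists l => //; apply: (@le_lt_trans _ _ (eps / 2)%:E); last first.
  by rewrite lte_fin ltr_pdivrMr// ltr_pMr// ltr1n.
apply: ge_ereal_sup => _ [t tT <-]; apply: ge_ereal_sup => _ [u Ku <-].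
by rewrite lee_fin -(gl t u tT) ltW//; exact: (yg (t, u)).
Qed.
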